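(* For every integer $n\ge 6$, $$\mathrm{sat}(n,\mathcal{C}_{\ge 6})=\begin{cases}9 & n=6;\\ 11 & n=7;\\ 12 & n=8;\\ 13 & n=9;\\ \left\lceil \frac{3(n-1)}{2}\right\rceil & n\ge 10.\end{cases}$$
   Context: All graphs are finite and simple. For an integer $r\ge 3$, $\mathcal{C}_{\ge r}$ denotes the family of all cycles of length at least $r$. For a family $\mathcal{F}$ of graphs, a graph $G$ is $\mathcal{F}$-saturated if $G$ contains no subgraph isomorphic to any member of $\mathcal{F}$, but for every pair of distinct nonadjacent vertices of $G$, adding the edge $e$ joining them yields a graph $G+e$ containing a copy of some member of $\mathcal{F}$ as a subgraph. The saturation number $\mathrm{sat}(n,\mathcal{F})$ is the minimum number of edges in an $n$-vertex $\mathcal{F}$-saturated graph. *)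

(* Defs.v *)
From mathcomp Require Import all_boot.

Set Implicit Arguments.
Unset Strict Implicit.
Unset Printing Implicit Defensive.

Record sgraph := SGraph {
  vert :> finType;
  adj : rel vert;
  adj_sym : symmetric adj;
  adj_irr : irreflexive adj
}.

Arguments adj {s} x y : rename.

Definition edges (G : sgraph) : {set {set G}} :=
  [set [set p.1; p.2] | p in [set p : G * G | adj p.1 p.2]].

(* [G] has a (not necessarily induced) subgraph isomorphic to [H]. *)
Definition contains (G H : sgraph) : Prop :=
  exists2 f : H -> G, injective f & forall x y : H, adj x y -> adj (f x) (f y).

Definition isomorphic (G H : sgraph) : Prop :=
  exists2 f : G -> H, bijective f & forall x y : G, adj (f x) (f y) = adj x y.

Definition add_edge_rel (G : sgraph) (a b : G) : rel G :=
  fun x y => adj x y || (x != y) && ([set x; y] == [set a; b]).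

Fact add_edge_sym (G : sgraph) (a b : G) : symmetric (add_edge_rel a b).
Proof. by move=> x y; rewrite /add_edge_rel adj_sym eq_sym setUC. Qed.

Fact add_edge_irr (G : sgraph) (a b : G) : irreflexive (add_edge_rel a b).
Proof. by move=> x; rewrite /add_edge_rel adj_irr eqxx. Qed.

Definition add_edge (G : sgraph) (a b : G) : sgraph :=
  SGraph (add_edge_sym a b) (add_edge_irr a b).

(* [ordS i] is the successor of [i] modulo [k]. This is the cycle of length [k]
   for [3 <= k] only; the conjunct [i != j] matters just for [k = 1]. *)
Definition cycle_rel (k : nat) : rel 'I_k :=
  fun i j => (i != j) && ((j == ordS i) || (i == ordS j)).

Fact cycle_rel_sym k : symmetric (@cycle_rel k).
Proof. by move=> i j; rewrite /cycle_rel eq_sym orbC. Qed.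

Fact cycle_rel_irr k : irreflexive (@cycle_rel k).
Proof. by move=> i; rewrite /cycle_rel eqxx. Qed.

Definition cycle_graph (k : nat) : sgraph :=
  SGraph (@cycle_rel_sym k) (@cycle_rel_irr k).

Definition graph_family := sgraph -> Prop.

(* Meant for [3 <= r]. *)
Definition cycles_geq (r : nat) : graph_family :=
  fun H => exists2 k, r <= k & isomorphic H (cycle_graph k).

Definition contains_member (F : graph_family) (G : sgraph) : Prop :=
  exists2 H, F H & contains G H.

Definition saturated (F : graph_family) (G : sgraph) : Prop :=
  ~ contains_member F G /\
  forall a b : G, a != b -> ~~ adj a b -> contains_member F (add_edge a b).

(* [sat(n, F) = m]. It is a relation because the minimum need not exist for an
   arbitrary family; the first conjunct asserts that it does. *)
Definition sat_number (n : nat) (F : graph_family) (m : nat) : Prop :=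
  (exists G : sgraph, [/\ #|G| = n, saturated F G & #|edges G| = m]) /\
  (forall G : sgraph, #|G| = n -> saturated F G -> m <= #|edges G|).

(* Main.v *)
(* A saturated graph stays saturated when it is cut at a cut vertex, because a path between two
   vertices of one side never leaves that side; this gives an induction in which 2e - 3(n - 1) is
   additive. Only bridges contribute a negative amount, -1. A bridge at [x] requires every other
   vertex of the rest to be reachable from [x] by a path on at least five vertices (call [x] good),
   so the induction carries the stronger bound 2e - 3(n - 1) >= number of good vertices, together
   with a variant that is sharp for small n.
   In a saturated block on at least six vertices, two cycles through a common vertex merge into a
   cycle of length five, a b c d f. Every further vertex then has exactly two neighbours, at
   distance two on that cycle, and for want of longer cycles these neighbourhoods are all {a, c} or {a, d} for
   a suitable labelling. A common neighbourhood {p, q} forces p and q to be adjacent and not good,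
   which leaves two explicit families of blocks.
   For n >= 7 extremal graphs are K_1 joined to a double star, with pendant edges attached at the
   vertices of degree two; for n = 6 it is K_4 and K_3 sharing a vertex. *)
Require Import Defs.
From mathcomp Require Import all_boot zify.

Set Implicit Arguments.
Unset Strict Implicit.
Unset Printing Implicit Defensive.

(** * Saturation of induced subgraphs *)

Section SaturatedSets.

Variables (T : finType) (e : rel T).
Hypotheses (esym : symmetric e) (eirr : irreflexive e).

Implicit Types (S A : {set T}) (x y z : T) (s c : seq T).

(* [s] omits the starting vertex [x], so [size s] is the number of edges of the path. *)
Definition upath S x y s :=
  [&& path e x s, last x s == y, uniq (x :: s) & all [in S] (x :: s)].

Definition short_cycles S :=
  forall c, cycle e c -> uniq c -> all [in S] c -> size c <= 5.

(** A long cycle created by adding the edge [x y] uses that edge, and what remains of it is a path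
    with at least five edges. *)
Definition linked S :=
  forall x y, x \in S -> y \in S -> x != y -> ~~ e x y ->
  exists2 s, upath S x y s & 5 <= size s.

Definition sat S := short_cycles S /\ linked S.

(* A pendant edge may be attached at [x] without destroying saturation. *)
Definition good S x :=
  x \in S /\
  forall y, y \in S -> y != x -> exists2 s, upath S x y s & 4 <= size s.

Definition arcs S := [set p : T * T | [&& p.1 \in S, p.2 \in S & e p.1 p.2]].

Definition nbr S x := [set y in S | e x y].

Lemma no_long_cycle S (l : seq T) : sat S ->
  cycle e l -> uniq l -> all [in S] l -> 6 <= size l -> False.
Proof. by case=> sc _ cl ul lS; rewrite leqNgt ltnS sc. Qed.

Lemma upath_sub S S' x y s : upath S x y s -> all [in S'] (x :: s) -> upath S' x y s.
Proof. by case/and4P=> ? ? ? _ ?; apply/and4P. Qed.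

Lemma upath_size S x y s : upath S x y s -> size s < #|S|.
Proof.
case/and4P=> _ _ u /allP sS.
by rewrite -[(size s).+1]/(size (x :: s)) cardE uniq_leq_size // => v /sS; rewrite mem_enum.
Qed.

Lemma upath_rev S x y s : upath S x y s ->
  exists2 s', upath S y x s' & size s' = size s.
Proof.
case/and4P=> p /eqP ly u a.
exists (rev (belast x s)); last by rewrite size_rev size_belast.
have E : y :: rev (belast x s) = rev (x :: s) by rewrite [x :: s]lastI rev_rcons ly.
apply/and4P; split.
- by rewrite -ly rev_path (eq_path (e' := e)).
- by have := congr1 (last y) E; rewrite [rev (x :: s)]rev_cons last_rcons /= => ->.
- by rewrite E rev_uniq.
- by rewrite E all_rev.
Qed.

Lemma arcs_deg S : #|arcs S| = \sum_(x in S) #|nbr S x|.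
Proof.
transitivity (\sum_(p in arcs S) 1); first by rewrite sum1_card.
rewrite (eq_bigl (fun p : T * T => (p.1 \in S) && ((p.2 \in S) && e p.1 p.2))); last first.
  by move=> p; rewrite inE.
rewrite -(pair_big_dep (mem S) (fun x y => (y \in S) && e x y) (fun _ _ => 1)) /=.
by apply: eq_bigr => x _; rewrite sum1_card; apply: eq_card => y; rewrite [RHS]inE.
Qed.

Lemma arcs_complete S : {in S &, forall x y, x != y -> e x y} ->
  #|arcs S| = #|S| * (#|S| - 1).
Proof.
move=> h; rewrite arcs_deg (eq_bigr (fun=> #|S| - 1)); first by rewrite sum_nat_const.
move=> x xS; rewrite (cardsD1 x S) xS add1n subn1 /=; apply: eq_card => y.
rewrite !inE; have [->|yx] /= := eqVneq y x; first by rewrite eirr andbF.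
by case yS: (y \in S) => //=; rewrite h // eq_sym.
Qed.

(** * Two sides sharing a cut vertex *)

Section Glue.

Variables (S1 S2 : {set T}) (z : T).
Hypothesis (cap : S1 :&: S2 = [set z]).
Hypothesis (nocross : forall x y, x \in S1 -> y \in S2 -> e x y -> x = z \/ y = z).

Lemma mem_cap x : x \in S1 -> x \in S2 -> x = z.
Proof. by move=> x1 x2; apply/set1P; rewrite -cap inE x1. Qed.

Lemma cut_in1 : z \in S1.
Proof. by have : z \in S1 :&: S2; [rewrite cap set11 | case/setIP]. Qed.

Lemma cut_in2 : z \in S2.
Proof. by have : z \in S1 :&: S2; [rewrite cap set11 | case/setIP]. Qed.

(** The first step of the path out of [S1] joins the two sides, so one of its ends is [z]. *)
Lemma crossing x s : path e x s -> all [in S1 :|: S2] s -> x \in S1 ->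
  last x s \in S2 -> z \in x :: s.
Proof.
elim: s x => [|w s IH] x /=; first by move=> _ _ x1 x2; rewrite (mem_cap x1 x2) mem_head.
case/andP=> xw p /andP[wS sS] x1 l2; rewrite inE.
case: (boolP (w \in S1)) => w1; first by rewrite (IH w) ?orbT.
have w2 : w \in S2 by move: wS; rewrite inE (negbTE w1).
by case: (nocross x1 w2 xw) => ->; rewrite ?eqxx // mem_head orbT.
Qed.

End Glue.

Section Glue2.

Variables (S1 S2 : {set T}) (z : T).
Hypothesis (cap : S1 :&: S2 = [set z]).
Hypothesis (nocross : forall x y, x \in S1 -> y \in S2 -> e x y -> x = z \/ y = z).

(** An excursion from [S1] to a vertex [w] and back would pass [z] both before and after [w], but a
    path visits [z] only once. *)
Lemma upath_side x y s : x \in S1 -> y \in S1 ->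
  upath (S1 :|: S2) x y s -> upath S1 x y s.
Proof.
move=> x1 y1 up; apply: upath_sub (up) _.
case/and4P: up => p /eqP ly u /allP sS; apply/allP => w ws; apply: contraT => w1.
have w2 : w \in S2 by move: (sS w ws); rewrite inE (negbTE w1).
have wx : w != x by apply: contraNneq w1 => ->.
move: ws; rewrite inE (negbTE wx) /= => ws.
case/splitPr: ws => s1 s2 in p ly u sS *.
move: p; rewrite cat_path => /andP[p1 /= /andP[ew p2]].
have z1 : z \in x :: rcons s1 w.
  apply: (crossing cap nocross) => //; rewrite ?rcons_path ?p1 ?last_rcons //.
  by apply/allP => v; rewrite mem_rcons => vs; apply: sS; move: vs;
     rewrite !(inE, mem_cat) => /orP[] ->; rewrite ?orbT.
have z2 : z \in w :: s2.
  apply: (@crossing S2 S1) => //; rewrite 1?setIC //.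
  - by move=> a b a2 b1; rewrite esym => /(nocross b1 a2) [|]; [right|left].
  - by apply/allP => v vs; rewrite setUC; apply: sS; rewrite inE mem_cat inE vs !orbT.
  - by move: ly; rewrite last_cat /= => ->.
have wz : w != z by apply: contraNneq w1 => ->; exact: cut_in1 cap.
move: u z1; rewrite -cat_cons cat_uniq => /and3P[_ /hasPn h _].
rewrite -rcons_cons mem_rcons inE eq_sym (negbTE wz) /= => zz.
by have /negP := h _ z2.
Qed.

Lemma sat_side : sat (S1 :|: S2) -> sat S1.
Proof.
move=> [sc lk]; split=> [c cc uc cS|x y x1 y1 xy nxy].
  by apply: sc => //; apply: sub_all cS => v; rewrite !inE => ->.
case: (lk x y) => // [||s us ss]; rewrite ?inE ?x1 ?y1 //.
by exists s => //; apply: upath_side.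
Qed.

Lemma good_side x : x \in S1 -> good (S1 :|: S2) x -> good S1 x.
Proof.
move=> x1 [_ g]; split=> // y y1 yx.
case: (g y) => // [|s us ss]; first by rewrite inE y1.
by exists s => //; apply: upath_side.
Qed.

Lemma arcs_glue : #|arcs (S1 :|: S2)| = #|arcs S1| + #|arcs S2|.
Proof.
have -> : arcs (S1 :|: S2) = arcs S1 :|: arcs S2.
  apply/setP => -[x y]; rewrite !inE /=; apply/idP/idP; last first.
    by case/orP=> /and3P[-> -> ->]; rewrite ?orbT.
  case/and3P=> xS yS xy; rewrite xy !andbT.
  have z1 := cut_in1 cap; have z2 := cut_in2 cap.
  case/orP: xS => x1; case/orP: yS => y1; rewrite ?x1 ?y1 ?orbT //.
    by case: (nocross x1 y1 xy) => E; move: x1 y1; rewrite E => x1 y1;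
       rewrite ?z1 ?z2 ?x1 ?y1 ?orbT.
  by case: (nocross y1 x1); rewrite 1?esym // => E; move: x1 y1; rewrite E => x1 y1;
       rewrite ?z1 ?z2 ?x1 ?y1 ?orbT.
(* An arc on both sides would be a loop at [z]. *)
rewrite cardsU (_ : _ :&: _ = set0) ?cards0 ?subn0 //.
apply/setP => -[x y]; rewrite !inE /=; apply/negP.
case/andP=> /and3P[x1 y1 xy] /and3P[x2 y2 _].
by move: xy; rewrite (mem_cap cap x1 x2) (mem_cap cap y1 y2) eirr.
Qed.

Lemma card_glue : (#|S1 :|: S2|).+1 = #|S1| + #|S2|.
Proof. by rewrite -cardsUI cap cards1 addn1. Qed.

End Glue2.

End SaturatedSets.

Ltac atom := first [ done | by rewrite eq_sym |
  by match goal with H : symmetric _ |- _ => rewrite H end | by auto ].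

(** Derives a contradiction from [l] as a forbidden long cycle. The conditions on [l] are split into
    single adjacencies, inequalities and memberships, which [atom] finds in the context up to
    symmetry. *)
Ltac close_cycle l :=
  exfalso; apply: (@no_long_cycle _ _ _ l);
  [ eassumption
  | rewrite /= ?rcons_cat ?cat_path /=
  | rewrite !(cons_uniq, cat_uniq) !(mem_cat, in_cons, in_nil) /= ?negb_or ?orbF ?negb_or
  | rewrite /= ?all_cat /=
  | rewrite /= ?size_cat /= ?addnS ?ltnS ?addn0 ];
  repeat (apply/andP; split); try atom.

(** * Connectivity and linking paths inside a vertex set *)

Section NoCutVertex.

Variables (T : finType) (e : rel T).
Hypotheses (esym : symmetric e) (eirr : irreflexive e).

Implicit Types (S A R : {set T}) (x y z : T) (s c p X Y : seq T).

Definition restr S : rel T := fun x y => [&& x \in S, y \in S & e x y].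

Definition connected S := {in S &, forall x y, connect (restr S) x y}.

Lemma restr_path S x s : x \in S -> path (restr S) x s = path e x s && all [in S] s.
Proof.
elim: s x => //= w s IH x xS; rewrite /restr xS /=.
by case wS: (w \in S); rewrite ?andbF //= IH // andbA.
Qed.

Lemma connect_upath S x y : x \in S -> connect (restr S) x y -> exists s, upath e S x y s.
Proof.
move=> xS /connectP[p pp ->]; case/shortenP: pp => s ps us _.
by exists s; move: ps us; rewrite restr_path // /upath /= => /andP[-> ->] ->; rewrite eqxx xS.
Qed.

Lemma upath_connect S x y s : upath e S x y s -> connect (restr S) x y.
Proof.
case/and4P=> p /eqP <- _ /= /andP[xS sS]; apply/connectP; exists s => //.
by rewrite restr_path // p.
Qed.

Lemma sat_connected S : sat e S -> connected S.
Proof.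
move=> [_ lk] x y xS yS; have [->|xy] := eqVneq x y; first exact: connect0.
case exy: (e x y); first by apply: connect1; rewrite /restr xS yS.
by have [//|s us _] := lk x y xS yS xy _; [rewrite exy | apply: upath_connect us].
Qed.

(** Restart a path from [X] to [Y] at a later vertex of [X] while there is one, then stop it at the
    first vertex of [Y]. The interior [s] then avoids both sets; it may be empty. *)
Lemma linkage R X Y x0 y0 : x0 \in R -> connect (restr R) x0 y0 -> x0 \in X -> y0 \in Y ->
  ~~ has [in X] Y ->
  exists x y s, [/\ x \in X, y \in Y, path e x s, e (last x s) y &
     uniq s && all (fun v => [&& v \in R, v \notin X & v \notin Y]) s].
Proof.
move=> x0R /(connect_upath x0R)[p /and4P[pp ly /= /andP[_ up] /andP[_ pR]]] xX yY XY.
have [n le_n] := ubnP (size p); elim: n => // n IH in p x0 x0R xX pp ly up pR le_n *.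
case: (boolP (has [in X] p)) => [/hasP[w wp wX]|/hasPn pX].
  case/splitPr: wp => p1 p2 in pp ly up pR le_n *.
  move: pp; rewrite cat_path /= => /and3P[_ _ pp2].
  move: up; rewrite cat_uniq /= => /and4P[_ _ _ up].
  move: pR; rewrite all_cat /= => /and3P[_ wR pR].
  apply: (IH p2 w) => //; first by move: ly; rewrite last_cat.
  by move: le_n; rewrite size_cat /=; lia.
case: (boolP (has [in Y] p)) => [|/hasPn pY]; last first.
  case: p ly {pp up pR le_n IH} pX pY => [|w p] /= /eqP ly pX pY.
    by move/negP: XY; case; apply/hasP; exists y0; rewrite // -ly.
  by move: (pY y0); rewrite -ly mem_last ly yY => /(_ isT).
move=> hasY; move: pp up pR pX; case/split_find: hasY => y s p2 /= yY' /hasPn sY pp up pR pX.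
exists x0, y, s; move: pp up pR pX.
rewrite -cats1 -catA cat_path cat_uniq all_cat /= => /and3P[-> -> _] /and3P[us _ _] /andP[sR _] pX.
split=> //; rewrite us; apply/allP => v vs /=.
rewrite (allP sR) //= (sY v vs) andbT; apply: pX.
by rewrite mem_cat vs.
Qed.

Lemma complete_cycle S : {in S &, forall x y, x != y -> e x y} -> 2 <= #|S| ->
  cycle e (enum S).
Proof.
move=> h; rewrite cardE; have := enum_uniq S; have : {subset enum S <= S}.
  by move=> v; rewrite mem_enum.
case: (enum S) => [|x s] //= sS /andP[xs us] ss.
rewrite rcons_path; apply/andP; split; last first.
  have l : last x s \in s by case: s ss {us xs sS} => //= a s _; rewrite mem_last.
  apply: h; rewrite ?sS ?mem_head ?in_cons ?l ?orbT //.
  by apply: contraNneq xs => <-.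
suff: pairwise e (x :: s) by move/pairwise_sorted.
have : uniq (x :: s) by rewrite /= xs.
rewrite uniq_pairwise; apply: (@sub_in_pairwise _ [in S] [rel x y | x != y]) => //.
by apply/allP.
Qed.

(** A path with five edges has six vertices, so no nonadjacent pair could be linked. *)
Lemma sat_small_complete S : sat e S -> #|S| <= 5 -> {in S &, forall x y, x != y -> e x y}.
Proof.
move=> [_ lk] S5 x y xS yS xy; apply: contraT => nxy.
by have [s /upath_size] := lk x y xS yS xy nxy; lia.
Qed.

Lemma good_card S x : good e S x -> 2 <= #|S| -> 5 <= #|S|.
Proof.
move=> [xS g]; rewrite (cardsD1 x) xS add1n ltnS card_gt0 => /set0Pn[y].
rewrite !inE => /andP[yx yS]; have [s /upath_size us ss] := g y yS yx.
by move: us; rewrite (cardsD1 x) xS; lia.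
Qed.

End NoCutVertex.

(** * Blocks on at least six vertices *)

Section FiveCycle.

Variables (T : finType) (e : rel T).
Hypotheses (esym : symmetric e) (eirr : irreflexive e).

Implicit Types (S A R : {set T}) (x y z : T) (s c p r X Y : seq T).

Lemma path_rcons_rev w z p :
  path e z p -> e w (last z p) -> path e w (rcons (rev p) z).
Proof.
move=> zp ew; rewrite -rev_cons [z :: p]lastI rev_rcons /= ew.
by rewrite rev_path (eq_path (e' := e)).
Qed.

(** At least one of the two arcs from [z] to [x] has two edges or more; if [x] follows [z] directly,
    it is the arc taken backwards. *)
Lemma cycle_arm z p x : cycle e (z :: p) -> uniq (z :: p) -> 2 <= size p -> x \in p ->
  exists p', [/\ path e z p', last z p' = x, uniq (z :: p'), {subset p' <= p} & 2 <= size p'].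
Proof.
move=> cp up sp xp; case/splitPr: xp => l r in cp up sp *.
case: l => [|a l] in cp up sp *; last first.
  exists (rcons (a :: l) x); rewrite last_rcons size_rcons.
  move: cp up; rewrite -cat_rcons /cycle rcons_cat cat_path -cat_cons cat_uniq.
  case/andP=> -> _ /andP[-> _].
  by split=> // v; rewrite mem_cat => ->.
exists (rev (x :: r)); rewrite size_rev cons_uniq mem_rev rev_uniq.
split=> //; try by move=> v; rewrite mem_rev.
- move: cp; rewrite /= rcons_path rev_cons => /and3P[_ pr rz].
  by apply: path_rcons_rev; rewrite // esym.
- by rewrite rev_cons last_rcons.
Qed.

(** Without [z] the set is still connected, so a path joins the two cycles away from [z]. Arms with
    at least two edges on either cycle and the vertex [z] give at least 2 + 2 + 1 vertices. *)
Lemma cycle_link S z p r : z \in S -> connected e (S :\ z) ->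
  all [in S] p -> all [in S] r -> ~~ has [in p] r ->
  cycle e (z :: p) -> uniq (z :: p) -> 2 <= size p ->
  cycle e (z :: r) -> uniq (z :: r) -> 2 <= size r ->
  exists c, [/\ cycle e c, uniq c, all [in S] c & 5 <= size c].
Proof.
move=> zS con pS rS pr cp up sp cr ur sr.
have [x0 x0p] : exists x, x \in p by case: p sp {pS pr cp up} => // a p; exists a; rewrite mem_head.
have [y0 y0r] : exists x, x \in r by case: r sr {rS pr cr ur} => // a r; exists a; rewrite mem_head.
have inSz q v : all [in S] q -> uniq (z :: q) -> v \in q -> v \in S :\ z.
  move=> qS /= /andP[zq _] vq; rewrite !inE (allP qS) // andbT.
  by apply: contraNneq zq => <-.
have x0S := inSz _ _ pS up x0p; have y0S := inSz _ _ rS ur y0r.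
have [x [y [s [xp yr ps sy /andP[us /allP sR]]]]] := linkage x0S (con _ _ x0S y0S) x0p y0r pr.
have [p' [pp' lp' up' pp sp']] := cycle_arm cp up sp xp.
have [r' [pr' lr' ur' rr sr']] := cycle_arm cr ur sr yr.
exists (z :: p' ++ s ++ rev r'); split.
- rewrite /= !rcons_cat !cat_path pp' lp' ps /=.
  by apply: path_rcons_rev => //; rewrite lr'.
- rewrite /= !cat_uniq rev_uniq has_cat us !mem_cat mem_rev !negb_or.
  move: up' ur' => /= /andP[-> ->] /andP[-> ->].
  rewrite !andbT /=; apply/and3P; split.
  + by apply/negP => /sR; rewrite !inE eqxx.
  + apply/andP; split; first by apply/hasPn => v /sR /and3P[_ h _]; apply: contraNN h => /pp.
    apply/hasPn => v; rewrite mem_rev => /rr vr; apply: contraNN pr => /pp vp.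
    by apply/hasP; exists v.
  + apply/hasPn => v; rewrite mem_rev => /rr vr; apply/negP => /sR /and3P[_ _].
    by rewrite vr.
- rewrite /= zS /= !all_cat; apply/and3P; split.
  + by apply/allP => v /pp; apply: (allP pS).
  + by apply/allP => v /sR; rewrite !inE -andbA => /and3P[].
  + by apply/allP => v; rewrite mem_rev => /rr; apply: (allP rS).
- by rewrite /= !size_cat size_rev; move: sp' sr'; clear; lia.
Qed.

Lemma far_nbr S a w s : e a w -> path e w s -> all [in S] (w :: s) -> a \notin w :: s ->
  ~~ e a (last w s) -> exists u v, [/\ u \in S, v \in S, e a u, e u v & (a != v) && ~~ e a v].
Proof.
elim: s w => [|v s IH] w aw /=; first by rewrite aw.
case/andP=> wv pv /and3P[wS vS sS] anws nl.
have avs : a \notin v :: s by move: anws; rewrite inE negb_or => /andP[].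
case av: (e a v); first by apply: (IH v) => //=; rewrite vS.
exists w, v; split=> //; rewrite av andbT.
by move: avs; rewrite inE negb_or => /andP[].
Qed.

Definition cycle5 S (a b c d f : T) :=
  [&& cycle e [:: a; b; c; d; f], uniq [:: a; b; c; d; f] & all [in S] [:: a; b; c; d; f]].

(** Since a complete [S] would carry a long cycle, some nonadjacent [x] and [y] have a common
    neighbour [z]. The long path from [x] to [y] closes up through [z], or passes through [z] and
    splits there into two cycles, which [cycle_link] merges. *)
Lemma exists_cycle5 S : sat e S -> (forall z, z \in S -> connected e (S :\ z)) -> 6 <= #|S| ->
  exists a b c d f : T, cycle5 S a b c d f.
Proof.
move=> satS con S6; have [sc lk] := satS.
suff [c [cc uc cS c5]] : exists c, [/\ cycle e c, uniq c, all [in S] c & 5 <= size c].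
  have := sc c cc uc cS; case: c cc uc cS c5 => [|a [|b [|c [|d [|f [|? ?]]]]]] // cc uc cS _ _.
  by exists a, b, c, d, f; apply/and3P.
have [x [z [y [xS zS yS xz zy]]]] : exists x z y,
    [/\ x \in S, z \in S, y \in S, e x z & e z y && ((x != y) && ~~ e x y)].
  case: (boolP [forall x in S, forall y in S, (x != y) ==> e x y]) => [/forall_inP h|].
    have := sc (enum S); rewrite -cardE enum_uniq complete_cycle ?(ltnW (ltnW (ltnW (ltnW S6)))) //.
      by move=> /(_ isT isT) h'; have : all [in S] (enum S); [apply/allP => v; rewrite mem_enum | move/h'; move: S6; clear; lia].
    by move=> x y xS yS; apply/implyP; have /forall_inP := h x xS; apply.
  rewrite negb_forall_in => /exists_inP[a aS]; rewrite negb_forall_in => /exists_inP[b bS].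
  rewrite negb_imply => /andP[ab nab]; have [s] := lk _ _ aS bS ab nab.
  case: s => // w s /and4P[/= /andP[aw pw] /eqP lb /andP[a_s us] /andP[_ sS]] _.
  have [|p [q [pS qS ap pq h]]] := @far_nbr S a w s aw pw sS a_s; first by rewrite lb.
  by exists a, p, q; rewrite pq.
case/and3P: zy => zy xy nxy; have [s us ss] := lk _ _ xS yS xy nxy.
case/and4P: us => ps /eqP ly us sS.
have zx : z != x by apply: contraTneq xz => ->; rewrite eirr.
have zy' : z != y by apply: contraTneq zy => ->; rewrite eirr.
case: (boolP (z \in s)) => zs; last first.
  exists (z :: x :: s); split=> //=.
  - by rewrite rcons_path esym xz ps ly esym.
  - by rewrite inE negb_or zx zs; move: us => /= ->.
  - by rewrite zS.
  - by apply: leq_trans ss _; rewrite -addn2 leq_addr.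
case/splitPr: zs => p r in ps ly us sS ss *.
case/lastP: r => [|r y'] in ps ly us sS ss *.
  by move: ly; rewrite last_cat /= => E; rewrite E eqxx in zy'.
move: ly; rewrite last_cat last_cons last_rcons => E; rewrite {}E {y'} in ps us sS ss *.
move: ps; rewrite cat_path /= => /and3P[pp pz pr].
move: us; rewrite -cat_cons cat_uniq => /and3P[up pzr ur].
move: sS; rewrite -cat_cons all_cat => /andP[pS /= /andP[_ rS]].
have cp : cycle e (z :: rev (x :: p)).
  rewrite /= rev_cons rcons_path last_rcons xz andbT.
  by apply: path_rcons_rev => //; rewrite esym.
have cr : cycle e (z :: rcons r y) by rewrite /= rcons_path pr last_rcons esym.
have up' : uniq (z :: rev (x :: p)).
  by rewrite cons_uniq mem_rev rev_uniq up andbT; move: pzr; rewrite /= negb_or => /andP[].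
have pS' : all [in S] (rev (x :: p)) by rewrite all_rev.
move: ss; rewrite size_cat /= size_rcons => ss.
(* If [p] or [r] is empty, the other holds at least three vertices and its cycle alone is long
   enough. *)
case: (posnP (size p)) => p1.
  exists (z :: rcons r y); split=> //; first by rewrite /= zS.
  by rewrite /= size_rcons; move: ss; rewrite p1.
case: (posnP (size r)) => r1.
  exists (z :: rev (x :: p)); split=> //; first by rewrite -[all _ _]/((z \in S) && all [in S] (rev (x :: p))) zS.
  by rewrite /= size_rev /=; move: ss; rewrite r1 addn2.
apply: (@cycle_link S z (rev (x :: p)) (rcons r y)) => //; rewrite ?size_rcons ?size_rev //.
- exact: con.
- by move: pzr; rewrite /= negb_or => /andP[_ /hasPn h]; apply/hasPn => v /h; rewrite /= mem_rev.
Qed.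

End FiveCycle.

(** * Vertices outside a five-cycle *)

Section Outside.

Variables (T : finType) (e : rel T).
Hypotheses (esym : symmetric e) (eirr : irreflexive e).
Variable S : {set T}.
Hypotheses (satS : sat e S) (con : forall z, z \in S -> connected e (S :\ z)).

Implicit Types a b c d f x y z v w : T.

Notation cycle5 := (cycle5 e S).
Notation nbr := (nbr e S).

Lemma cycle5P a b c d f : cycle5 a b c d f ->
  [/\ [/\ e a b, e b c, e c d, e d f & e f a],
      [/\ a != b, a != c, a != d & a != f],
      [/\ b != c, b != d, b != f & [/\ c != d, c != f & d != f]] &
      [/\ a \in S, b \in S, c \in S, d \in S & f \in S]].
Proof.
case/and3P=> /= /and5P[? ? ? ? /andP[? _]].
rewrite !inE !negb_or => /and5P[/and4P[-> -> -> ->] /and3P[-> -> ->] /andP[-> ->] -> _].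
by case/and5P=> -> -> -> -> /andP[->].
Qed.

Lemma cycle5_rot a b c d f : cycle5 a b c d f -> cycle5 b c d f a.
Proof.
case/and3P=> h1 h2 h3; apply/and3P.
by rewrite -(rot_cycle 1) -(rot_uniq 1) -(eq_all_r (mem_rot 1 _)) in h1 h2 h3.
Qed.

Lemma cycle5_rev a b c d f : cycle5 a b c d f -> cycle5 a f d c b.
Proof.
case/cycle5P=> [[? ? ? ? ?] [? ? ? ?] [? ? ? [? ? ?]] [? ? ? ? ?]].
by apply/and3P; rewrite /= !inE !negb_or; split; do !(apply/andP; split); atom.
Qed.

(** A case of [linkage]: since [z] is no cut vertex, [x] has an ear to [Y] whose interior avoids
    [z]. *)
Lemma ear z x y0 (Y : seq T) : z \in S -> x \in S -> x != z -> y0 \in S -> y0 != z ->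
  y0 \in Y -> x \notin Y -> exists y s,
  [/\ y \in Y, path e x s, e (last x s) y, uniq s &
    all [in S] s /\ forall v, v \in z :: x :: Y -> v \notin s].
Proof.
move=> zS xS xz yS yz yY xY.
have xR : x \in S :\ z by rewrite !inE xz.
have yR : y0 \in S :\ z by rewrite !inE yz.
have [||x' [y [s [+ yY' ps sy /andP[us /allP sR]]]]] :=
  linkage (X := [:: x]) (Y := Y) xR (con zS xR yR) _ yY.
- by rewrite inE.
- by apply/hasPn => v vY; rewrite inE; apply: contraNneq xY => <-.
rewrite inE => /eqP E; rewrite {}E in ps sy *.
exists y, s; split=> //; split; first by apply/allP => v /sR; rewrite !inE -andbA => /and3P[].
move=> v; rewrite !inE => vin; apply/negP => /sR.
rewrite !inE; case/or3P: vin => [->//|->|->]; rewrite ?andbF //=; by rewrite andbF.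
Qed.

Ltac open5 H :=
  let h := fresh in have h := cycle5P H;
  case: h => [[? ? ? ? ?] [? ? ? ?] [? ? ? [? ? ?]] [? ? ? ? ?]].

(** As [a] is no cut vertex, [x] has a second way back to the cycle. Ending at [b] or [f], next to
    [a], it would lengthen the cycle; ending at [c] or [d], it must be a single edge. *)
Lemma out_two a b c d f x : cycle5 a b c d f -> x \in S -> x \notin [:: a; b; c; d; f] ->
  e x a -> e x c \/ e x d.
Proof.
move=> C xS; rewrite !inE !negb_or; open5 C => /and5P[xa xb xc xd xf] exa.
have [||||||| y [s [yY ps sy us [sS sn]]]] := @ear a x b [:: b; c; d; f]; try atom.
- by rewrite mem_head.
- by rewrite !inE !negb_or xb xc xd.
have [an xn bn cn [dn fn]] : [/\ a \notin s, x \notin s, b \notin s, c \notin s & d \notin s /\ f \notin s].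
  by do !split; apply: sn; rewrite !inE eqxx ?orbT.
move: yY; rewrite !inE => /or4P[] /eqP E; rewrite {}E in sy.
- by close_cycle (a :: x :: s ++ [:: b; c; d; f]).
- have [s0|s0] := posnP (size s); first by left; rewrite (size0nil s0) in sy.
  by close_cycle (a :: x :: s ++ [:: c; d; f]).
- have [s0|s0] := posnP (size s); first by right; rewrite (size0nil s0) in sy.
  by close_cycle (a :: x :: s ++ [:: d; c; b]).
- by close_cycle (a :: x :: s ++ [:: f; d; c; b]).
Qed.

(** A third neighbour on the cycle allows an immediate six-cycle. A neighbour [w] off the cycle has
    an ear back to it that avoids [x]; this closes through [c] when it ends at [a], and through [a]
    otherwise. *)
Lemma nbr_out a b c d f x : cycle5 a b c d f -> x \in S -> x \notin [:: a; b; c; d; f] ->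
  e x a -> e x c -> nbr x = [set a; c].
Proof.
move=> C xS; rewrite !inE !negb_or; open5 C => /and5P[xa xb xc xd xf] exa exc.
apply/setP => w; rewrite !inE; apply/andP/orP; last by case=> /eqP->.
case=> wS exw.
have [E|wa] := eqVneq w a; first by left.
have [E|wc] := eqVneq w c; first by right.
have [E|wb] := eqVneq w b; first by subst w; close_cycle [:: a; x; b; c; d; f].
have [E|wd] := eqVneq w d; first by subst w; close_cycle [:: a; b; c; x; d; f].
have [E|wf] := eqVneq w f; first by subst w; close_cycle [:: a; x; f; d; c; b].
have wx : w != x by apply: contraTneq exw => ->; rewrite eirr.
have [||||||| y [s [yY ps sy us [sS sn]]]] := @ear x w a [:: a; b; c; d; f]; try atom.
- by rewrite mem_head.
- by rewrite !inE !negb_or wa wb wc wd.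
have [an xn bn cn [dn fn]] : [/\ a \notin s, x \notin s, b \notin s, c \notin s & d \notin s /\ f \notin s].
  by do !split; apply: sn; rewrite !inE eqxx ?orbT.
have wn : w \notin s by apply: sn; rewrite !inE eqxx ?orbT.
move: yY; rewrite !inE => yY.
case/or4P: yY => [/eqP E|/eqP E|/eqP E|/orP[] /eqP E]; rewrite {}E in sy.
- by close_cycle (c :: x :: w :: s ++ [:: a; f; d]).
- by close_cycle (a :: x :: w :: s ++ [:: b; c; d; f]).
- by close_cycle (a :: x :: w :: s ++ [:: c; d; f]).
- by close_cycle (a :: x :: w :: s ++ [:: d; c; b]).
- by close_cycle (a :: x :: w :: s ++ [:: f; d; c; b]).
Qed.

Lemma type_of_adj a b c d f x : cycle5 a b c d f -> x \in S -> x \notin [:: a; b; c; d; f] ->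
  e x a -> nbr x = [set a; c] \/ nbr x = [set a; d].
Proof.
move=> C xS xC xa; case: (out_two C xS xC xa) => h; first by left; apply: nbr_out C _ _ _ _.
right; apply: nbr_out (cycle5_rev C) _ _ _ _ => //.
by apply: contraNN xC; rewrite !inE => /or4P[->|->|->|/orP[]->]; rewrite ?orbT.
Qed.

(** The five pairs at distance two on the cycle, listed as the successive rotations of {a, c}. *)
Definition out_type a b c d f x :=
  [\/ nbr x = [set a; c], nbr x = [set b; d], nbr x = [set c; f] |
     nbr x = [set d; a] \/ nbr x = [set f; b]].

Lemma notin_rot x a b c d f : x \notin [:: a; b; c; d; f] -> x \notin [:: b; c; d; f; a].
Proof. by rewrite -(mem_rot 1). Qed.

Lemma adj_out_type a b c d f x v : cycle5 a b c d f -> x \in S -> x \notin [:: a; b; c; d; f] ->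
  v \in [:: a; b; c; d; f] -> e x v -> out_type a b c d f x.
Proof.
move=> C0 xS x0.
have C1 := cycle5_rot C0; have C2 := cycle5_rot C1; have C3 := cycle5_rot C2; have C4 := cycle5_rot C3.
have x1 := notin_rot x0; have x2 := notin_rot x1; have x3 := notin_rot x2; have x4 := notin_rot x3.
rewrite !inE => /or4P[/eqP->|/eqP->|/eqP->|/orP[] /eqP->] xv.
- by case: (type_of_adj C0 xS x0 xv) => h; [apply: Or41|apply: Or44; left; rewrite setUC].
- by case: (type_of_adj C1 xS x1 xv) => h; [apply: Or42|apply: Or44; right; rewrite setUC].
- by case: (type_of_adj C2 xS x2 xv) => h; [apply: Or43|apply: Or41; rewrite setUC].
- by case: (type_of_adj C3 xS x3 xv) => h; [apply: Or44; left|apply: Or42; rewrite setUC].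
- by case: (type_of_adj C4 xS x4 xv) => h; [apply: Or44; right|apply: Or43; rewrite setUC].
Qed.

(** Follow a path from [x] to the cycle. If it had an interior, the last interior vertex [w] would
    have both its neighbours on the cycle, although the vertex before [w] on the path lies off
    it. *)
Lemma outside5 a b c d f x : cycle5 a b c d f -> x \in S -> x \notin [:: a; b; c; d; f] ->
  out_type a b c d f x.
Proof.
move=> C xS xC; have [_ _ _ [aS _ _ _ _]] := cycle5P C.
have [||x' [v [s [xx' vC ps sv /andP[us /allP sR]]]]] :=
  linkage (X := [:: x]) (Y := [:: a; b; c; d; f]) xS (sat_connected satS xS aS) _ (mem_head _ _).
- exact: mem_head.
- by apply/hasPn => v vC; rewrite inE; apply: contraNneq xC => <-.
move: xx'; rewrite inE => /eqP E; rewrite {}E in ps sv.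
case/lastP: s => [|s w] in ps sv us sR *; first exact: adj_out_type vC sv.
move: ps sv; rewrite rcons_path last_rcons => /andP[_ uw] wv.
have /and3P[wS _ wC] : [&& w \in S, w \notin [:: x] & w \notin [:: a; b; c; d; f]].
  by apply: sR; rewrite mem_rcons mem_head.
have /andP[lS lC] : (last x s \in S) && (last x s \notin [:: a; b; c; d; f]).
  case/lastP: s sR {us uw} => [|s u] sR; first by rewrite xS.
  rewrite last_rcons; have /and3P[-> _ ->] // : [&& u \in S, u \notin [:: x] & u \notin [:: a; b; c; d; f]].
  by apply: sR; rewrite mem_rcons inE mem_rcons mem_head orbT.
have : last x s \in nbr w by rewrite inE lS esym.
by case: (adj_out_type C wS wC vC wv) => [h|h|h|[h|h]]; rewrite {}h => h; exfalso; move: h lC;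
  rewrite !inE => /orP[] ->; rewrite ?orbT.
Qed.

Lemma nbr2 x p q : nbr x = [set p; q] ->
  [/\ e x p, e x q & forall w, w \in S -> e x w -> w = p \/ w = q].
Proof.
move=> h; have hp : p \in nbr x by rewrite h set21.
have hq : q \in nbr x by rewrite h set22.
move: hp hq; rewrite !inE => /andP[_ ->] /andP[_ ->]; split=> // w wS xw.
by apply/set2P; rewrite -h inE wS.
Qed.

(** All outside vertices hang on the hub [a]; the vertex [x0] records that the pair {a, c} really
    occurs. *)
Definition fan a b c d f x0 :=
  [/\ cycle5 a b c d f, x0 \in S, x0 \notin [:: a; b; c; d; f], nbr x0 = [set a; c] &
   forall y, y \in S -> y \notin [:: a; b; c; d; f] -> nbr y = [set a; c] \/ nbr y = [set a; d]].

(** Rotate so that some outside vertex has the pair {a, c}. The pairs {b, d} and {f, b} then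
    complete seven-cycles, and {a, d} and {c, f} together a six-cycle, so at most one of the latter
    two accompanies {a, c}. *)
Lemma exists_fan : 6 <= #|S| -> exists a b c d f x0, fan a b c d f x0.
Proof.
move=> S6; have [a [b [c [d [f C]]]]] := exists_cycle5 esym eirr satS con S6.
have [x xS xC] : exists2 x, x \in S & x \notin [:: a; b; c; d; f].
  apply/subsetPn; apply: contraTN S6 => /subset_leq_card h; rewrite -leqNgt.
  by apply: leq_trans h _; apply: card_size.
wlog xt : a b c d f C xC / nbr x = [set a; c] => [main|].
  have C1 := cycle5_rot C; have C2 := cycle5_rot C1; have C3 := cycle5_rot C2; have C4 := cycle5_rot C3.
  have x1 := notin_rot xC; have x2 := notin_rot x1; have x3 := notin_rot x2; have x4 := notin_rot x3.
  case: (outside5 C xS xC) => [h|h|h|[h|h]].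
  - exact: main C xC h.
  - exact: main C1 x1 h.
  - exact: main C2 x2 h.
  - exact: main C3 x3 h.
  - exact: main C4 x4 h.
have types y : y \in S -> y \notin [:: a; b; c; d; f] ->
    [\/ nbr y = [set a; c], nbr y = [set a; d] | nbr y = [set c; f]].
  move=> yS yC; have [xa xc _] := nbr2 xt.
  case: (outside5 C yS yC) => [h|h|h|[h|h]].
  - exact: Or31.
  - move: xC yC; rewrite !inE !negb_or; open5 C => /and5P[? ? ? ? ?] /and5P[? ? ? ? ?].
    have [yb yd _] := nbr2 h; have xy : x != y.
      by apply/eqP => E; have := set21 a c; rewrite -xt E h !inE; apply/negP; rewrite negb_or; do !(apply/andP; split); atom.
    by close_cycle [:: a; x; c; b; y; d; f].
  - exact: Or33.
  - by apply: Or32; rewrite setUC.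
  - move: xC yC; rewrite !inE !negb_or; open5 C => /and5P[? ? ? ? ?] /and5P[? ? ? ? ?].
    have [yf yb _] := nbr2 h; have xy : x != y.
      by apply/eqP => E; have := set21 a c; rewrite -xt E h !inE; apply/negP; rewrite negb_or; do !(apply/andP; split); atom.
    by close_cycle [:: a; x; c; d; f; y; b].
have [/exists_inP[y yS /andP[yC /eqP yt]]|none] :=
  boolP [exists y in S, (y \notin [:: a; b; c; d; f]) && (nbr y == [set c; f])]; last first.
  exists a, b, c, d, f, x; split=> // y yS yC; case: (types y yS yC) => h; [by left|by right|].
  by case/exists_inP: none; exists y; rewrite // yC h eqxx.
(* The reflection that fixes [b] exchanges [a] with [c] and [d] with [f], so {c, f} becomes {a,
   d}. *)
have permC v : (v \in [:: c; b; a; f; d]) = (v \in [:: a; b; c; d; f]).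
  by rewrite -[RHS](mem_rot 3) -[RHS]mem_rev.
exists c, b, a, f, d, x; split=> //; rewrite ?permC 1?setUC //.
  exact: cycle5_rot (cycle5_rot (cycle5_rot (cycle5_rev C))).
move=> w wS; rewrite permC => wC; case: (types w wS wC) => h; [by left| |by right].
exfalso; have [yc yf _] := nbr2 yt; have [wa wd _] := nbr2 h.
have wy : w != y.
  apply/eqP => E; have := set21 a d; rewrite -h E yt !inE; apply/negP.
  by open5 C; rewrite negb_or; do !(apply/andP; split); atom.
move: wC yC; rewrite !inE !negb_or; open5 C => /and5P[? ? ? ? ?] /and5P[? ? ? ? ?].
by close_cycle [:: a; w; d; c; y; f].
Qed.

End Outside.

(** * Counting degrees in a block *)

Section Block.

Variables (T : finType) (e : rel T).
Hypotheses (esym : symmetric e) (eirr : irreflexive e).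
Variable S : {set T}.
Hypotheses (satS : sat e S) (con : forall z, z \in S -> connected e (S :\ z)).

Implicit Types a b c d f x y z v w p q : T.

Notation cycle5 := (cycle5 e S).
Notation nbr := (nbr e S).

(* Otherwise the path, which then avoids [x], closes through [x] to a long cycle. *)
Lemma common_nbr_path x p q s : x \in S -> nbr x = [set p; q] -> p != q ->
  upath e S p q s -> size s <= 3.
Proof.
move=> xS h pq /and4P[ps /eqP lq us sS]; have [xp xq hx] := nbr2 h.
have px : x != p by apply: contraTneq xp => ->; rewrite eirr.
have qx : x != q by apply: contraTneq xq => ->; rewrite eirr.
have [xs|xs] := boolP (x \in s); last first.
  have := no_long_cycle (l := x :: p :: s) satS; rewrite /= rcons_path xp ps lq esym xq.
  rewrite inE negb_or px xs xS; move: us sS => /= -> -> /(_ isT isT isT) /negP.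
  by rewrite -leqNgt !ltnS; lia.
case/splitPr: xs => s1 s2 in ps lq us sS *.
case: s2 => [|w s2] in ps lq us sS *.
  by move: lq qx; rewrite last_cat /= => ->; rewrite eqxx.
move: ps; rewrite cat_path /= => /and4P[_ ux xw ps2].
have inS v : v \in p :: s1 ++ [:: x, w & s2] -> v \in S by move/(allP sS).
have wS : w \in S by apply: inS; rewrite inE mem_cat !inE eqxx !orbT.
have uS : last p s1 \in S by apply: inS; rewrite -cat_cons mem_cat mem_last.
have := us; rewrite -cat_cons cat_uniq => /and3P[us1 /hasPn dis /= /and3P[_ ws2 _]].
have wl : w \notin p :: s1 by apply: dis; rewrite !inE eqxx orbT.
have wp : w <> p by move=> E; rewrite E mem_head in wl.
case: (hx w wS xw) => // wq; move: lq; rewrite last_cat /= => lq.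
have s20 : s2 = [::].
  by case: s2 ws2 lq {ps2 us sS dis inS} => //= v s2 ws2 lq; move: ws2; rewrite wq -lq mem_last.
have [|up|uq] := hx (last p s1) uS; first by rewrite esym.
  have -> : s1 = [::].
    case: s1 us1 up {us sS ux uS inS dis wl} => //= v s1 /andP[ps1 _] up.
    by move: ps1; rewrite -{1}up mem_last.
  by rewrite s20.
by move: wl; rewrite wq -uq mem_last.
Qed.

(** Nonadjacent [p] and [q] would need a path with five edges, and [common_nbr_path] allows only
    three. *)
Lemma common_nbr_adj x p q : x \in S -> nbr x = [set p; q] -> p != q ->
  p \in S -> q \in S -> e p q.
Proof.
move=> xS h pq pS qS; apply: contraT => npq; case: satS => _ lk.
by have [s /(common_nbr_path xS h pq)] := lk p q pS qS pq npq; lia.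
Qed.

Lemma common_nbr_not_good x p q : x \in S -> nbr x = [set p; q] -> p != q ->
  q \in S -> ~ good e S p.
Proof.
move=> xS h pq qS [_ g]; have qp : q != p by rewrite eq_sym.
by have [s /(common_nbr_path xS h pq)] := g q qS qp; lia.
Qed.

(** The successor of [v] is not the starting vertex [p], so it is [q]; the predecessor is then [p],
    and [v] comes right after it. *)
Lemma inner_is_head p q v s : v \in S -> nbr v = [set p; q] -> upath e S p (last p s) s ->
  v \in s -> v != last p s -> v = head v s.
Proof.
move=> vS h /and4P[ps _ us sS] vs vl; have [_ _ hx] := nbr2 h.
case/splitPr: vs => s1 s2 in ps vl us sS *.
case: s2 => [|w s2] in ps vl us sS *; first by move: vl; rewrite last_cat /= eqxx.
move: ps; rewrite cat_path /= => /and4P[_ uv vw _].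
have inS u : u \in p :: s1 ++ [:: v, w & s2] -> u \in S by move/(allP sS).
have wS : w \in S by apply: inS; rewrite inE mem_cat !inE eqxx !orbT.
have uS : last p s1 \in S by apply: inS; rewrite -cat_cons mem_cat mem_last.
move: us; rewrite -cat_cons cat_uniq => /and3P[us1 /hasPn dis _].
have wl : w \notin p :: s1 by apply: dis; rewrite !inE eqxx orbT.
have wp : w <> p by move=> E; rewrite E mem_head in wl.
case: (hx w wS vw) => // wq.
have [|up|uq] := hx (last p s1) uS; first by rewrite esym.
  case: s1 us1 up {sS uv uS inS dis wl vl} => //= u s1 /andP[ps1 _] up.
  by move: ps1; rewrite -{1}up mem_last.
by move: wl; rewrite wq -uq mem_last.
Qed.

(** By [inner_is_head], a path from [h] to [y] contains at most one vertex besides [p], [q], [y],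
    [z], namely the one after [h]. With at most five vertices it has at most four edges, too few for
    a nonadjacent pair. *)
Lemma small_core_adj p q y z h :
  (forall v, v \in S -> v \notin [:: p; q; y; z] -> nbr v = [set p; q]) ->
  h \in [:: p; q] -> h \in S -> y \in S -> h != y -> e h y.
Proof.
move=> all2 hpq hS yS hy; apply: contraT => nhy; case: satS => _ lk.
have [s up s5] := lk h y hS yS hy nhy; have [/and4P[ps /eqP ly us /allP sS]] := (up).
suff sub : {subset h :: s <= [:: p; q; y; z; head h s]}.
  by have := uniq_leq_size us sub; rewrite /=; lia.
move=> v vs; have [|vn] := boolP (v \in [:: p; q; y; z]).
  by rewrite !inE => /or4P[] ->; rewrite ?orbT.
have vS := sS v vs; have nv := all2 v vS vn.
move: vs vn; rewrite inE; case: eqVneq => [-> _|vh /= vs vn].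
  by move: hpq; rewrite !inE => /orP[] ->; rewrite ?orbT.
have vl : v != last h s.
  by apply: contraNneq vn => ->; rewrite ly !inE eqxx !orbT.
suff -> : v = head h s by rewrite !inE eqxx !orbT.
have E : head h s = head v s by case: s vs {up ps ly us sS s5 vl}.
rewrite E; move: hpq; rewrite !inE => /orP[] /eqP eh; subst h.
  by apply: (@inner_is_head p q v s) => //; rewrite ly.
by apply: (@inner_is_head q p v s) => //; rewrite ?ly // setUC.
Qed.

Lemma nbr_adj a : a \in S -> (forall v, v \in S -> v != a -> e a v) -> #|nbr a| = #|S|.-1.
Proof.
move=> aS h; rewrite [X in X.-1](cardsD1 a) aS /=; apply: eq_card => v; rewrite !inE.
have [->|va] := eqVneq v a; first by rewrite eirr andbF.
by case vS: (v \in S); rewrite //= h.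
Qed.

Lemma le_nbr v (l : seq T) : uniq l -> all [in S] l -> all (e v) l -> size l <= #|nbr v|.
Proof.
move=> ul /allP lS /allP lv; rewrite cardE; apply: uniq_leq_size => // w wl.
by rewrite mem_enum inE lS ?lv.
Qed.

(** In both families [a] is adjacent to every other vertex. If the pair {a, d} occurs besides {a,
    c}, the degree sum is at least 4n - 6 and none of [a], [c], [d] is good; otherwise the sum is at
    least 4n - 4 and neither [a] nor [c] is good. *)
Lemma block_arcs : 6 <= #|S| ->
  2 * #|S| + 7 <= #|arcs e S| /\
  forall A : {set T}, (forall x, x \in A -> good e S x) -> 3 * #|S| + #|A| <= #|arcs e S| + 3.
Proof.
move=> S6; have [a [b [c [d [f [x [C xS xC nx out]]]]]]] := exists_fan esym eirr satS con S6.
have [[ab bc cd df fa] [n1 n2 n3 n4] [n5 n6 n7 [n8 n9 n10]] [aS bS cS dS fS]] := cycle5P C.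
have ac : e a c by apply: common_nbr_adj nx _ _ _.
have xn : [/\ x != a, x != b, x != c, x != d & x != f].
  by move: xC; rewrite !inE !negb_or => /and5P[-> -> -> -> ->].
have outn v : v \in S -> v \notin [:: a; b; c; d; f] -> e v a.
  by move=> vS vC; case: (out v vS vC) => /nbr2[].
have [Sc Sf] : c \in S :\ a /\ f \in S :\ a :\ c.
  by rewrite !inE cS fS (eq_sym c a) (eq_sym f) (eq_sym f) n2 n4 n9.
have Sd : d \in S :\ a :\ c by rewrite !inE (eq_sym d c) (eq_sym d a) n8 n3.
have Sfd : f \in S :\ a :\ c :\ d by rewrite in_setD1 Sf eq_sym n10.
have card2 : #|S| = #|S :\ a :\ c| + 2.
  by rewrite (cardsD1 a) aS (cardsD1 c) Sc !add1n addn2.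
have card3 : #|S| = #|S :\ a :\ c :\ d| + 3.
  by rewrite card2 (cardsD1 d) Sd add1n addn2 addn3.
have card4 : #|S| = #|S :\ a :\ c :\ d :\ f| + 4.
  by rewrite card3 (cardsD1 f) Sfd add1n addn3 addn4.
have ngood p q y : y \in S -> q \in S -> p != q -> nbr y = [set p; q] ->
    forall A : {set T}, (forall v, v \in A -> good e S v) -> p \notin A.
  move=> yS qS pq ny A gA; apply/negP => /gA; exact: common_nbr_not_good yS ny pq qS.
have AS (A : {set T}) : (forall v, v \in A -> good e S v) -> A \subset S :\ a :\ c.
  move=> gA; rewrite !subsetD1 (ngood a c x) // (ngood c a x) // 1?setUC 1?eq_sym // andbT andbT.
  by apply/subsetP => v /gA[].
have inC v : v \in [:: a; b; c; d; f] -> [\/ v = a, v = b, v = c | v = d \/ v = f].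
  by rewrite !inE => /or4P[/eqP->|/eqP->|/eqP->|/orP[]/eqP->];
     [apply: Or41|apply: Or42|apply: Or43|apply: Or44; left|apply: Or44; right].
rewrite arcs_deg (big_setD1 a) //= (big_setD1 c) //= (big_setD1 d) //=.
have [/exists_inP[y yS /andP[yC /eqP ny]]|none] :=
  boolP [exists y in S, (y \notin [:: a; b; c; d; f]) && (nbr y == [set a; d])].
  have ead : e a d by apply: common_nbr_adj ny _ _ _.
  have [xa xc _] := nbr2 nx; have [ya yd _] := nbr2 ny.
  have na : #|nbr a| = #|S|.-1.
    apply: nbr_adj => // v vS va; have [/inC vC|vC] := boolP (v \in [:: a; b; c; d; f]).
      by move: va; case: vC => [->|->|->|[->|->]]; rewrite ?eqxx // esym.
    by rewrite esym outn.
  (* At n = 6 the bound 2n + 7 would not follow from 4n - 6, but two different pairs need two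
     outside vertices. *)
  have S7 : 7 <= #|S|.
    rewrite cardE; apply: (@uniq_leq_size _ [:: x; y; a; b; c; d; f]).
      rewrite 2!cons_uniq yC inE negb_or xC andbT; case/and3P: C => _ -> _; rewrite andbT.
      apply/andP; split=> //; apply: contraTneq n8 => E.
      have : c \in nbr y by rewrite -E nx set22.
      by rewrite ny !inE (eq_sym c a) (negbTE n2) /= => ->.
    by move=> v; rewrite mem_enum !inE; do !case/orP=> [/eqP->|] //; move/eqP->.
  (* Every vertex is adjacent to [c] or to [d], and [a] to both, whence the additional 1. *)
  have ncd : #|S| + 1 <= #|nbr c| + #|nbr d|.
    rewrite -cardsUI leq_add //.
      apply: subset_leq_card; apply/subsetP => v vS; rewrite !inE vS /=.
      have [/inC vC|vC] := boolP (v \in [:: a; b; c; d; f]).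
        by case: vC => [->|->|->|[->|->]]; rewrite ?cd ?df ?orbT // esym ?ac ?bc ?cd ?orbT.
      by case: (out v vS vC) => /nbr2[_ h _]; [rewrite (esym c) h | rewrite (esym d) h orbT].
    by rewrite card_gt0; apply/set0Pn; exists a; rewrite !inE aS esym ac esym ead.
  have rest : \sum_(v in S :\ a :\ c :\ d) #|nbr v| >= 2 * #|S :\ a :\ c :\ d|.
    rewrite mulnC -sum_nat_const; apply: leq_sum => v; rewrite !inE => /and4P[vd vc va vS].
    have [/inC vC|vC] := boolP (v \in [:: a; b; c; d; f]).
      move: vd vc va; case: vC => [->|->|->|[->|->]]; rewrite ?eqxx // => _ _ _.
        by apply: (@le_nbr _ [:: a; c]); rewrite /= ?inE ?n2 ?aS ?cS ?bc // esym ab.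
      by apply: (@le_nbr _ [:: a; d]); rewrite /= ?inE ?n3 ?aS ?dS ?fa // esym df.
    case: (out v vS vC) => /nbr2[? ? _].
      by apply: (@le_nbr _ [:: a; c]); rewrite /= ?inE; do !(apply/andP; split).
    by apply: (@le_nbr _ [:: a; d]); rewrite /= ?inE; do !(apply/andP; split).
  have arith n k i j l r m : i = n.-1 -> n + 1 <= j + l -> 2 * k <= r -> n = k + 3 -> 7 <= n ->
      m <= k -> 2 * n + 7 <= i + (j + (l + r)) /\ 3 * n + m <= i + (j + (l + r)) + 3.
    by clear; lia.
  split; first by case: (arith _ _ _ _ _ _ 0 na ncd rest card3 S7 _).
  move=> A gA; have : A \subset S :\ a :\ c :\ d.
    by rewrite subsetD1 AS //= (ngood d a y) // 1?setUC 1?eq_sym.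
  by move/subset_leq_card => m; case: (arith _ _ _ _ _ _ _ na ncd rest card3 S7 m).
have out1 v : v \in S -> v \notin [:: a; b; c; d; f] -> nbr v = [set a; c].
  move=> vS vC; case: (out v vS vC) => // h; case/exists_inP: none.
  by exists v; rewrite // vC h eqxx.
have [xa xc _] := nbr2 nx.
(* [x] can replace [b] on the cycle, so [b] behaves like an outside vertex; chords from [b] to [d]
   or [f] would close six-cycles through [x]. *)
have nb : nbr b = [set a; c].
  apply/setP => w; rewrite !inE; apply/andP/orP; last first.
    by case=> /eqP->; rewrite ?aS ?cS // esym.
  case=> wS bw; have [/inC wC|wC] := boolP (w \in [:: a; b; c; d; f]); last first.
    have [_ _ /(_ b bS)] := nbr2 (out1 w wS wC); rewrite esym bw.
    by case=> // E; move: n1 n5; rewrite E eqxx.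
  case: xn wC bw => ? ? ? ? ? [->|->|->|[->|->]]; rewrite ?eqxx ?eirr //; try by [left|right].
    by move=> bd; close_cycle [:: a; x; c; b; d; f].
  by move=> bf; close_cycle [:: a; x; c; d; f; b].
have all2 v : v \in S -> v \notin [:: a; c; d; f] -> nbr v = [set a; c].
  move=> vS vn; have [->//|vb] := eqVneq v b; apply: out1 => //.
  by move: vn; rewrite !inE (negbTE vb).
(* All vertices but [a], [c], [d], [f] now have neighbourhood {a, c}, so [small_core_adj] joins [a]
   to [d] and [c] to [f]. This brings [d] and [f] to degree three. *)
have ead : e a d by apply: (@small_core_adj a c d f) => //; rewrite mem_head.
have ecf : e c f.
  apply: (@small_core_adj a c f d) => //; rewrite ?inE ?eqxx ?orbT //.
  by move=> v vS vn; apply: all2 => //; move: vn; rewrite !inE (orbC (v == f)).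
rewrite (big_setD1 f) //=.
have na : #|nbr a| = #|S|.-1.
  apply: nbr_adj => // v vS va; have [/inC vC|vC] := boolP (v \in [:: a; b; c; d; f]).
    by move: va; case: vC => [->|->|->|[->|->]]; rewrite ?eqxx // esym.
  by rewrite esym outn.
have nc : #|nbr c| = #|S|.-1.
  apply: nbr_adj => // v vS va; have [/inC vC|vC] := boolP (v \in [:: a; b; c; d; f]).
    by move: va; case: vC => [->|->|->|[->|->]]; rewrite ?eqxx // esym.
  by have [_ h _] := nbr2 (out1 v vS vC); rewrite esym.
have nd : 3 <= #|nbr d|.
  apply: (@le_nbr _ [:: a; c; f]); rewrite /= ?inE ?negb_or ?n2 ?n4 ?n9 ?aS ?cS ?fS // df.
  by rewrite esym ead esym cd.
have nf : 3 <= #|nbr f|.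
  apply: (@le_nbr _ [:: a; c; d]); rewrite /= ?inE ?negb_or ?n2 ?n3 ?n8 ?aS ?cS ?dS // fa.
  by rewrite esym ecf esym df.
have rest : \sum_(v in S :\ a :\ c :\ d :\ f) #|nbr v| >= 2 * #|S :\ a :\ c :\ d :\ f|.
  rewrite mulnC -sum_nat_const; apply: leq_sum => v; rewrite !inE => /and5P[vf vd vc va vS].
  have [|? ? _] := @nbr2 _ e S v a c; first by rewrite all2 // !inE !negb_or va vc vd.
  by apply: (@le_nbr _ [:: a; c]); rewrite /= ?inE; do !(apply/andP; split).
have arith n k k' i j l t r m : i = n.-1 -> j = n.-1 -> 3 <= l -> 3 <= t -> 2 * k <= r ->
    n = k' + 2 -> n = k + 4 -> 6 <= n -> m <= k' ->
    2 * n + 7 <= i + (j + (l + (t + r))) /\ 3 * n + m <= i + (j + (l + (t + r))) + 3.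
  by clear; lia.
split; first by case: (arith _ _ _ _ _ _ _ _ 0 na nc nd nf rest card2 card4 S6 _).
move=> A /AS/subset_leq_card m.
by case: (arith _ _ _ _ _ _ _ _ _ na nc nd nf rest card2 card4 S6 m).
Qed.

End Block.

(** * Lower bound *)

Section ArcBounds.

Variables (T : finType) (e : rel T).
Hypotheses (esym : symmetric e) (eirr : irreflexive e).

Implicit Types (S A : {set T}) (x y z u v w : T).

Definition cut_at S1 S2 z :=
  S1 :&: S2 = [set z] /\
  forall x y, x \in S1 -> y \in S2 -> e x y -> x = z \/ y = z.

Lemma cut_atC S1 S2 z : cut_at S1 S2 z -> cut_at S2 S1 z.
Proof.
case=> cap nc; split; first by rewrite setIC.
by move=> x y x2 y1; rewrite esym => /(nc y x y1 x2)[]; [right|left].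
Qed.

(** If [z] separates [x] from [y], one side is the component [K] of [x] together with [z], the other
    everything outside [K]. *)
Lemma cut_vertex S : (forall z, z \in S -> connected e (S :\ z)) \/
  exists S1 S2 z, [/\ S = S1 :|: S2, cut_at S1 S2 z, 2 <= #|S1| & 2 <= #|S2|].
Proof.
case: (boolP [forall z in S, forall x in S :\ z, forall y in S :\ z, connect (restr e (S :\ z)) x y]).
  move=> /forall_inP h; left=> z zS x y xS yS.
  by have /forall_inP/(_ x xS)/forall_inP/(_ y yS) := h z zS.
rewrite negb_forall_in => /exists_inP[z zS]; rewrite negb_forall_in => /exists_inP[x xS].
rewrite negb_forall_in => /exists_inP[y yS nxy]; right.
pose K := [set w in S :\ z | connect (restr e (S :\ z)) x w].
have KE w : (w \in K) = (w \in S :\ z) && connect (restr e (S :\ z)) x w by rewrite inE.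
clearbody K.
have KS w : w \in K -> w \in S by rewrite KE in_setD1 -andbA => /and3P[].
have zK : z \notin K by rewrite KE in_setD1 eqxx.
have xK : x \in K by rewrite KE xS connect0.
have yK : y \notin K by rewrite KE (negbTE nxy) andbF.
exists (z |: K), (S :\: K), z; split.
- apply/setP => w; rewrite !inE; have [->|wz] /= := eqVneq w z; first by rewrite zS.
  by case wK: (w \in K); rewrite //= (KS w wK).
- split.
    apply/setP => w; rewrite !inE; have [->|wz] /= := eqVneq w z; first by rewrite zK.
    by case: (w \in K).
  move=> u v; rewrite in_setU1 => /orP[/eqP->|uK]; first by left.
  rewrite inE => /andP[vK vS] uv; have [->|vz] := eqVneq v z; [by right|].
  case/negP: vK; rewrite KE in_setD1 vz vS /=.
  move: uK; rewrite KE => /andP[uS xu]; apply: connect_trans xu (connect1 _).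
  by rewrite /restr uS in_setD1 vz vS.
- by rewrite cardsU1 zK (cardsD1 x) xK.
- have yz : y \in (S :\: K) :\ z by move: yS; rewrite !in_setD yK.
  by rewrite (cardsD1 z) in_setD zK zS (cardsD1 y) yz.
Qed.

(** The number of arcs is 2e. The second clause says e >= n + 3 and, by parity, e >= n + 4 in the
    strict case. It mentions good vertices because a pendant edge attached to a set on six vertices
    yields one on seven, where the strict form is due. *)
Definition arc_bounds S :=
  (forall A, (forall x, x \in A -> good e S x) -> 3 * #|S| + #|A| <= #|arcs e S| + 3) /\
  (6 <= #|S| -> 2 * #|S| + 6 <= #|arcs e S| /\
     (7 <= #|S| \/ (exists x, good e S x) -> 2 * #|S| + 7 <= #|arcs e S|)).

Lemma good_set_card S A : (forall x, x \in A -> good e S x) -> 2 <= #|S| ->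
  #|A| <= #|S| /\ (5 <= #|S| \/ #|A| = 0).
Proof.
move=> gA S2; split; first by apply/subset_leq_card/subsetP => x /gA[].
have [->|[x /gA/good_card h]] := set_0Vmem A; first by right; rewrite cards0.
by left; apply: h.
Qed.

Lemma small_arcs S : sat e S -> #|S| <= 5 -> #|arcs e S| = #|S| * (#|S| - 1).
Proof. by move=> satS S5; apply: arcs_complete (sat_small_complete satS S5). Qed.

(** Such a set is complete, and it can have good vertices only if n = 5, where 20 arcs leave room
    for all five. *)
Lemma small_arc_bounds S : sat e S -> 3 <= #|S| <= 5 -> arc_bounds S.
Proof.
move=> satS /andP[S3 S5]; have S2 : 2 <= #|S| by apply: leq_trans S3.
split=> [A gA|]; last by rewrite ltnNge S5.
have [cA gA'] := good_set_card gA S2; rewrite (small_arcs satS S5).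
move: S3 S5 cA gA'; clear; move: #|S| #|A| => n m.
by case: n => [|[|[|[|[|[|n]]]]]] //; lia.
Qed.

(** A pendant edge adds two arcs where three are required. The missing one comes from [z], which is
    good in [S1] but no longer in the union. *)
Lemma glue_edge S1 S2 z : cut_at S1 S2 z -> sat e (S1 :|: S2) -> 5 <= #|S1 :|: S2| ->
  #|S2| = 2 -> arc_bounds S1 -> arc_bounds (S1 :|: S2).
Proof.
move=> cut satS S5 S22 [B1 B2]; have [cap nc] := cut; have [cap' nc'] := cut_atC cut.
have z1 := cut_in1 cap; have z2 := cut_in2 cap.
have sat1 : sat e S1 := sat_side esym cap nc satS.
have sat2 : sat e S2 by apply: (sat_side esym cap' nc'); rewrite setUC.
have a2 : #|arcs e S2| = 2 by rewrite small_arcs // S22.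
have ga := arcs_glue esym eirr cap nc; have gc := card_glue cap.
have c1 : #|S2 :\ z| = 1 by apply/succn_inj; rewrite -S22 (cardsD1 z S2) z2.
have [y y2 yz] : exists2 y, y \in S2 & y != z.
  have : 0 < #|S2 :\ z| by rewrite c1.
  by rewrite card_gt0 => /set0Pn[y]; rewrite !inE => /andP[? ?]; exists y.
have S2E v : v \in S2 -> v = z \/ v = y.
  move=> v2; have [|vz] := eqVneq v z; [by left|right].
  have /cards1P[t tE] : #|S2 :\ z| == 1 by rewrite c1.
  have : y \in S2 :\ z by rewrite in_setD1 yz.
  have : v \in S2 :\ z by rewrite in_setD1 vz.
  by rewrite tE !inE => /eqP-> /eqP->.
(* The pendant vertex [y] must have a path with five edges to [w], and it starts with the edge to
   [z]. *)
have gz : good e S1 z.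
  split=> // w w1 wz; have yw : y != w.
    by apply: contraNneq yz => E; rewrite (mem_cap cap _ y2) // E.
  have nyw : ~~ e y w.
    by apply/negP; rewrite esym => /(nc w y w1 y2)[] E; rewrite E eqxx in wz yz.
  have [_ lk] := satS; have [||s] := lk y w _ _ yw nyw; rewrite ?inE ?y2 ?w1 ?orbT //.
  case: s => // h s /and4P[/= /andP[yh ps] lw /andP[yns us] /and3P[yS hS sS]] s4.
  have hz : h = z.
    case/setUP: hS => [h1|/S2E[//|E]]; last by move: yh; rewrite E eirr.
    by move: yh; rewrite esym => /(nc h y h1 y2)[//|E]; rewrite E eqxx in yz.
  subst h; exists s => //; apply: (upath_side esym cap nc) => //.
  by rewrite /upath /= ps lw us in_setU z1.
have ng v w : v \in S2 -> w \in S2 -> v != w -> ~ good e (S1 :|: S2) v.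
  move=> v2 w2 vw; rewrite setUC => /(good_side esym cap' nc' v2)[_ /(_ w w2)].
  by rewrite eq_sym => /(_ vw)[s /upath_size]; rewrite S22; lia.
have n1 := good_card gz; have n12 : #|S1 :|: S2| = #|S1| + 1 by move: gc; rewrite S22; lia.
have S15 : 5 <= #|S1| by apply: n1; move: n12 S5; clear; lia.
have gA1 x : good e (S1 :|: S2) x -> x \in S1 :\ z.
  move=> gx; have [xS _] := gx; case/setUP: (xS) => [x1|/S2E[] E].
  - rewrite in_setD1 x1 andbT; apply/eqP => E; subst x.
    by apply: (ng z y) => //; rewrite eq_sym.
  - by subst x; case: (ng z y) => //; rewrite eq_sym.
  - by subst x; case: (ng y z).
have gA2 x : good e (S1 :|: S2) x -> good e S1 x.
  by move=> gx; have := gA1 x gx; rewrite in_setD1 => /andP[_ x1]; apply: (good_side esym cap nc).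
split=> [A gA|S6].
  have zA : z \notin A by apply/negP => /gA/gA1; rewrite !inE eqxx.
  have : 3 * #|S1| + #|z |: A| <= #|arcs e S1| + 3.
    by apply: B1 => x /setU1P[->//|/gA/gA2].
  by rewrite cardsU1 zA ga a2 n12; clear; lia.
suff : 2 * #|S1 :|: S2| + 7 <= #|arcs e (S1 :|: S2)| by lia.
(* Since [z] is good, [S1] has at least five vertices: with five it is complete and has 20 arcs,
   with more the good vertex [z] gives the strict bound. *)
rewrite ga a2 n12; have [n5|n6] := leqP #|S1| 5.
  have E : #|S1| = 5 by apply/eqP; rewrite eqn_leq n5.
  by rewrite small_arcs ?E.
have [_ h] := B2 n6; have : 2 * #|S1| + 7 <= #|arcs e S1| by apply: h; right; exists z.
by clear; lia.
Qed.

(** A good vertex stays good on each side that contains it, so the first bounds simply add. Sides on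
    three or four vertices are complete and enter the second bound with their exact numbers of
    arcs. *)
Lemma glue_blocks S1 S2 z : cut_at S1 S2 z -> sat e (S1 :|: S2) -> 6 <= #|S1 :|: S2| ->
  3 <= #|S1| -> 3 <= #|S2| -> arc_bounds S1 -> arc_bounds S2 -> arc_bounds (S1 :|: S2).
Proof.
move=> cut satS S6 S13 S23 [B11 B12] [B21 B22]; have [cap nc] := cut; have [cap' nc'] := cut_atC cut.
have sat1 : sat e S1 := sat_side esym cap nc satS.
have sat2 : sat e S2 by apply: (sat_side esym cap' nc'); rewrite setUC.
have ga := arcs_glue esym eirr cap nc; have gc := card_glue cap.
split=> [A gA|_].
  have AS : A \subset S1 :|: S2 by apply/subsetP => x /gA[].
  have h1 : 3 * #|S1| + #|A :&: S1| <= #|arcs e S1| + 3.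
    by apply: B11 => x /setIP[/gA gx x1]; apply: (good_side esym cap nc).
  have h2 : 3 * #|S2| + #|A :&: S2| <= #|arcs e S2| + 3.
    by apply: B21 => x /setIP[/gA gx x1]; apply: (good_side esym cap' nc'); rewrite // setUC.
  have : #|A| <= #|A :&: S1| + #|A :&: S2|.
    by rewrite -cardsUI -setIUr (setIidPl AS) leq_addr.
  rewrite ga; move: h1 h2 gc; clear; lia.
have lower S' : sat e S' -> 3 <= #|S'| -> (6 <= #|S'| -> 2 * #|S'| + 6 <= #|arcs e S'|) ->
    [\/ #|S'| = 3 /\ #|arcs e S'| = 6, #|S'| = 4 /\ #|arcs e S'| = 12 |
        5 <= #|S'| /\ 2 * #|S'| + 6 <= #|arcs e S'|].
  move=> sat' S3 h; have [S5|S5] := leqP #|S'| 5; last by apply: Or33; split; [apply: ltnW|apply: h].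
  rewrite small_arcs //; move: S3 S5; clear; move: #|S'| => n.
  case: n => [|[|[|[|[|[|n]]]]]] // _ _; [exact: Or31|exact: Or32|exact: Or33].
have l1 := lower S1 sat1 S13 (fun h => proj1 (B12 h)).
have l2 := lower S2 sat2 S23 (fun h => proj1 (B22 h)).
split.
  by rewrite ga; case: l1 l2 => [[p1 q1]|[p1 q1]|[p1 q1]] [[p2 q2]|[p2 q2]|[p2 q2]];
     move: p1 q1 p2 q2 gc S6; clear; lia.
(* Only a triangle and a [K_4] together miss the strict bound; they have six vertices in all, and
   neither is large enough for a good vertex. *)
suff h : 7 <= #|S1 :|: S2| \/ (5 <= #|S1| \/ 5 <= #|S2|) -> 2 * #|S1 :|: S2| + 7 <= #|arcs e (S1 :|: S2)|.
  move=> [n7|[x gx]]; first by apply: h; left.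
  apply: h; right; have [/setUP[x1|x2] _] := gx; [left|right].
    by apply: good_card (good_side esym cap nc x1 gx) (ltnW S13).
  by apply: good_card (good_side esym cap' nc' x2 _) (ltnW S23); rewrite setUC.
by rewrite ga; case: l1 l2 => [[p1 q1]|[p1 q1]|[p1 q1]] [[p2 q2]|[p2 q2]|[p2 q2]];
  move: p1 q1 p2 q2 gc S6; clear; lia.
Qed.

(** Induction on the size of [S]. A cut leaves two smaller sides; a side with two vertices, for
    which the first bound fails, is treated as a pendant edge. *)
Theorem sat_arc_bounds S : sat e S -> 3 <= #|S| -> arc_bounds S.
Proof.
have [n le_n] := ubnP #|S|; elim: n S le_n => // n IH S le_n satS S3.
have [S5|S6] := leqP #|S| 5; first by apply: small_arc_bounds; rewrite // S3.
case: (cut_vertex S) => [con|[S1 [S2 [z [E cut n1 n2]]]]].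
  have [h1 h2] := block_arcs esym eirr satS con S6.
  by split=> // _; split=> //; apply: leq_trans h1; rewrite leq_add2l.
have [cap nc] := cut; have [cap' nc'] := cut_atC cut.
rewrite {}E {S} in le_n satS S3 S6 *.
have sat1 : sat e S1 := sat_side esym cap nc satS.
have sat2 : sat e S2 by apply: (sat_side esym cap' nc'); rewrite setUC.
have gc := card_glue cap.
have lt1 : #|S1| < n by move: gc le_n n2; clear; lia.
have lt2 : #|S2| < n by move: gc le_n n1; clear; lia.
have [m2|m2] := leqP #|S2| 2.
  apply: (glue_edge cut) => //; first exact: ltnW.
    by apply/eqP; rewrite eqn_leq m2.
  by apply: IH => //; move: gc S6 m2; clear; lia.
have [m1|m1] := leqP #|S1| 2.
  rewrite setUC; apply: (glue_edge (cut_atC cut)); rewrite 1?setUC //; first exact: ltnW.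
    by apply/eqP; rewrite eqn_leq m1.
  by apply: IH.
by apply: (glue_blocks cut) => //; apply: IH.
Qed.

End ArcBounds.

(** * Cycles as sequences *)

Lemma cycle_nthP (V : Type) (x0 : V) (e : rel V) c :
  reflect (forall i, i < size c -> e (nth x0 c i) (nth x0 c (i.+1 %% size c))) (cycle e c).
Proof.
case: c => [|x s]; first by left.
have E i : i < (size s).+1 -> nth x0 (x :: rcons s x) i = nth x0 (x :: s) i /\
    nth x0 (rcons s x) i = nth x0 (x :: s) (i.+1 %% (size s).+1).
  move=> lti; split; first by rewrite -rcons_cons nth_rcons /= lti.
  rewrite nth_rcons; have [lt|le] := ltnP i (size s); first by rewrite modn_small.
  have -> : i = size s by apply/eqP; rewrite eqn_leq le andbT -ltnS.
  by rewrite eqxx modnn.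
rewrite [cycle _ _]/=; apply: (iffP (pathP x0)); rewrite size_rcons => h i lti.
  by have [<- <-] := E i lti; apply: h.
by have [-> ->] := E i lti; apply: h.
Qed.

Lemma cycle_rel_succ k (i : 'I_k) : 2 <= k -> cycle_rel i (ordS i).
Proof.
move=> k2; rewrite /cycle_rel eqxx andbT -val_eqE /=.
have := ltn_ord i; rewrite leq_eqVlt => /orP[/eqP E|lt]; last by rewrite modn_small // neq_ltn ltnSn.
by rewrite E modnn; case: k i k2 E => [|[|k]] // i _ [->].
Qed.

Lemma contains_longP (G : sgraph) : contains_member (cycles_geq 6) G <->
  exists c : seq G, [/\ cycle adj c, uniq c & 6 <= size c].
Proof.
split=> [[H [k k6 [g [g' gK g'K] gadj]] [f finj fadj]]|[c [cc uc c6]]].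
  have k2 : 2 <= k by apply: leq_trans k6.
  pose i0 : 'I_k := Ordinal (ltnW k2); pose F i := f (g' i).
  have [L [sL uL nL]] : exists L : seq 'I_k,
      [/\ size L = k, uniq L & forall i : 'I_k, nth i0 L i = i].
    by exists (enum 'I_k); split; [exact: size_enum_ord|exact: enum_uniq|exact: nth_ord_enum].
  exists (map F L); split; last by rewrite size_map sL.
    apply/(cycle_nthP (F i0)) => i; rewrite size_map sL => lti.
    rewrite !(nth_map i0) ?sL ?ltn_pmod ?(ltnW k2) // (nL (Ordinal lti)) (nL (ordS (Ordinal lti))).
    by apply: fadj; rewrite -gadj !g'K; apply: cycle_rel_succ.
  by rewrite map_inj_uniq // => i j /finj /(can_inj g'K).
case: c cc uc c6 => // x0 s; move: (x0 :: s) => c cc uc c6.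
exists (cycle_graph (size c)); first by exists (size c) => //; exists id => //; exists id.
exists (fun i : 'I_(size c) => nth x0 c i).
  by move=> i j /eqP; rewrite nth_uniq ?ltn_ord // => /eqP/val_inj.
have h (i : 'I_(size c)) : adj (nth x0 c i) (nth x0 c (ordS i)).
  exact: (cycle_nthP x0 adj c cc).
by move=> i j /andP[_ /orP[] /eqP->]; rewrite ?h // adj_sym h.
Qed.

Lemma add_edge_relE (G : sgraph) (a b x y : G) : add_edge_rel a b x y ->
  adj x y \/ (x = a /\ y = b) \/ (x = b /\ y = a).
Proof.
case/orP=> [|/andP[xy /eqP E]]; [by left|right].
have := set21 x y; have := set22 x y; rewrite E !inE.
by case/orP=> /eqP Ey /orP[] /eqP Ex; move: xy; rewrite Ex Ey ?eqxx //; [right|left].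
Qed.

(** Rotate a long cycle of [add_edge a b] to start at [a]. The new edge is its first or its last
    step, and dropping it leaves the required path between [a] and [b]. *)
Lemma saturatedP (G : sgraph) : saturated (cycles_geq 6) G <-> sat (@adj G) [set: G].
Proof.
have aT (s : seq G) : all [in [set: G]] s by apply/allP => v; rewrite inE.
split=> [[nc add]|[sc lk]].
  have sc : short_cycles (@adj G) [set: G].
    move=> c cc uc _; rewrite leqNgt; apply/negP => c6.
    by apply: nc; apply/contains_longP; exists c.
  split=> // a b _ _ ab nab.
  have /contains_longP[/= c [cc uc c6]] := add a b ab nab.
  have ac : a \in c.
    apply: contraT => ac; suff : size c <= 5 by rewrite leqNgt c6.
    apply: sc => //; apply: (sub_in_cycle (P := [in c])) (cc) => [x y xc yc|]; last exact/allP.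
    by case/add_edge_relE=> [//|[[E _]|[_ E]]]; move: ac; rewrite -E ?xc ?yc.
  case/rot_to: ac => i s E; rewrite -(rot_cycle i) -(rot_uniq i) -(size_rot i) E in cc uc c6.
  have [as_ us] := andP uc.
  have adj' x y : x \in s -> y \in s -> add_edge_rel a b x y -> adj x y.
    by move=> xs ys /add_edge_relE[//|[[E' _]|[_ E']]]; move: as_; rewrite -E' ?xs ?ys.
  case: s as_ us adj' uc c6 cc {E} => // w s anws us adj' uc c6 /=.
  rewrite rcons_path => /and3P[aw pw la].
  have pw' : path adj w s.
    by apply: (sub_in_path (P := [in w :: s])) pw => //; apply/allP.
  (* Of the two steps at [a] exactly one is new: two old ones give a long cycle of [G], two new ones
     visit [b] twice. *)
  have [aw'|[[_ wb]|[ab' _]]] := add_edge_relE aw; last by rewrite ab' eqxx in ab.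
    have [la'|[[lb' _]|[lb _]]] := add_edge_relE la.
    - suff : size [:: a, w & s] <= 5 by rewrite leqNgt c6.
      by apply: sc; [rewrite /= rcons_path aw' pw'|exact: uc|exact: aT].
    - by move: anws; rewrite -lb' mem_last.
    by exists (w :: s) => //; apply/and4P; split;
      [rewrite /= aw'|rewrite /= lb|exact: uc|exact: aT].
  subst w; have [la'|[[lb' _]|[lb _]]] := add_edge_relE la.
  - have up : upath (@adj G) [set: G] b a (rcons s a).
      apply/and4P; split; [by rewrite rcons_path pw' la'|by rewrite last_rcons| |exact: aT].
      by move: uc; rewrite -(rot_uniq 1) rot1_cons.
    have [s' up' ss'] := upath_rev (@adj_sym G) up; exists s' => //.
    by rewrite ss' size_rcons.
  - by move: anws; rewrite -lb' mem_last.
  - case: s us c6 lb {pw la pw' uc adj' anws} => //= v s /andP[bs _] _ lb.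
    by rewrite -lb mem_last in bs.
split.
  by case/contains_longP=> c [cc uc]; rewrite ltnNge sc.
move=> a b ab nab; have [s /and4P[ps /eqP lb us _] s5] := lk a b (in_setT a) (in_setT b) ab nab.
apply/contains_longP; exists (a :: s); split=> //=.
rewrite rcons_path lb; apply/andP; split; first by apply: sub_path ps => x y xy; rewrite /add_edge_rel xy.
by rewrite /add_edge_rel eq_sym ab setUC eqxx orbT.
Qed.

Lemma card_arcs (G : sgraph) : #|arcs (@adj G) [set: G]| = 2 * #|edges G|.
Proof.
have -> : edges G = [set [set p.1; p.2] | p in arcs (@adj G) [set: G]].
  rewrite /edges (_ : [set p : G * G | adj p.1 p.2] = arcs (@adj G) [set: G]) //.
  by apply/setP => p; rewrite !inE.
set P := arcs _ _; pose F (p : G * G) := [set p.1; p.2].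
rewrite -sum1_card (partition_big_imset F) /= mulnC -sum_nat_const.
apply: eq_bigr => E /imsetP[[x y] xyP ->]; rewrite sum1_card.
have xy : adj x y by move: xyP; rewrite inE => /and3P[].
have nxy : x != y by apply: contraTneq xy => ->; rewrite adj_irr.
have <- : #|[set (x, y); (y, x)]| = 2 by rewrite cards2 xpair_eqE (negbTE nxy).
apply: eq_card => -[u v]; rewrite [LHS]inE [RHS]inE !in_set1 !xpair_eqE [in LHS]inE !in_setT /= /F /=.
apply/andP/orP => [[uv /eqP E']|[/andP[/eqP-> /eqP->]|/andP[/eqP-> /eqP->]]]; last 2 first.
- by rewrite xy eqxx.
- by rewrite adj_sym xy setUC eqxx.
have nuv : u != v by apply: contraTneq uv => ->; rewrite adj_irr.
have := set21 u v; have := set22 u v; rewrite E' !inE => /orP[] /eqP Ev /orP[] /eqP Eu;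
  move: nuv; rewrite Ev Eu ?eqxx // => _; [by right|by left].
Qed.

(** * Extremal graphs *)

Lemma card_arcs_sum (G : sgraph) : #|arcs (@adj G) [set: G]| = \sum_(x : G) \sum_(y : G) adj x y.
Proof.
rewrite arcs_deg (eq_bigl xpredT) => [|x]; last by rewrite inE.
apply: eq_bigr => x _; rewrite -sum1_card big_mkcond /=; apply: eq_bigr => y _.
by rewrite !inE; case: (adj x y).
Qed.

Lemma next_neq_prev (T : eqType) (c : seq T) x : uniq c -> 3 <= size c -> x \in c ->
  next c x != prev c x.
Proof.
move=> uc c3 xc; have [i s E] := rot_to xc.
rewrite -(next_rot i uc) -(prev_rot i uc) E.
move: uc c3; rewrite -(rot_uniq i) -(size_rot i) E; case: s {E} => [|y [|z s]] // /andP[xs us] _.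
rewrite prev_nth mem_head memNindex //= eqxx -[nth _ _ _]/(nth x (z :: s) (size s)) -last_nth.
by apply: contraNneq (proj1 (andP us)) => ->; rewrite mem_last.
Qed.

(* The cone, with apex [inl tt], over the double star with centres [bool] and leaves ['I_m], and
   a pendant vertex attached to each of the first [r] leaves. *)
Definition cone_vert m r : finType := (unit + (bool + ('I_m + 'I_r)))%type.

(** The leaves 0 and 1 belong to the centre [false], the others to [true], so with four leaves or
    more each centre has at least two. *)
Definition side m (i : 'I_m) : bool := 2 <= i.

Definition cone_rel m r : rel (cone_vert m r) := fun x y =>
  match x, y with
  | inl _, inr (inl _) | inr (inl _), inl _ => true
  | inl _, inr (inr (inl _)) | inr (inr (inl _)), inl _ => true
  | inr (inl b), inr (inl b') => b != b'
  | inr (inl b), inr (inr (inl i)) | inr (inr (inl i)), inr (inl b) => b == side i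
  | inr (inr (inl i)), inr (inr (inr j)) | inr (inr (inr j)), inr (inr (inl i)) => i == j :> nat
  | _, _ => false
  end.

Fact cone_sym m r : symmetric (@cone_rel m r).
Proof. by move=> [[]|[b|[i|j]]] [[]|[b'|[i'|j']]] //=; rewrite eq_sym. Qed.

Fact cone_irr m r : irreflexive (@cone_rel m r).
Proof. by move=> [[]|[b|[i|j]]] //=; rewrite eqxx. Qed.

Definition cone m r : sgraph := SGraph (@cone_sym m r) (@cone_irr m r).

Lemma card_cone m r : #|cone m r| = m + r + 3.
Proof. by rewrite !card_sum card_unit card_bool !card_ord; lia. Qed.

Lemma sum_unit (F : unit -> nat) : \sum_x F x = F tt.
Proof. by rewrite (big_pred1 tt) // => -[]. Qed.

Lemma sum_matching m r : r <= m -> \sum_(i < m) \sum_(j < r) (i == j :> nat) = r.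
Proof.
move=> rm; rewrite exchange_big /= -[RHS]card_ord -sum1_card; apply: eq_bigr => j _.
rewrite (bigD1 (widen_ord rm j)) //= eqxx big1 // => i.
by rewrite -val_eqE /= => /negbTE->.
Qed.

Lemma edges_cone m r : r <= m -> #|edges (cone m r)| = 2 * m + r + 3.
Proof.
move=> rm; apply/eqP; rewrite -(eqn_pmul2l (isT : 0 < 2)) -card_arcs card_arcs_sum.
have leaf_sum : \sum_(i < m) \sum_(y : cone m r) adj (inr (inr (inl i)) : cone m r) y = 2 * m + r.
  transitivity (\sum_(i < m) (2 + \sum_(j < r) (i == j :> nat))).
    apply: eq_bigr => i _; rewrite !(big_sumType, sum_unit, big_bool) /= sum_nat_const muln0.
    by case: (side i).
  by rewrite big_split sum_nat_const card_ord sum_matching //= mulnC.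
have pendant_sum : \sum_(j < r) \sum_(y : cone m r) adj (inr (inr (inr j)) : cone m r) y = r.
  transitivity (\sum_(j < r) \sum_(i < m) (i == j :> nat)).
    by apply: eq_bigr => j _; rewrite !(big_sumType, sum_unit, big_bool) /= big1_eq !(addn0, add0n).
  by rewrite exchange_big sum_matching.
have sides : \sum_(i < m) (true == side i) + \sum_(i < m) (false == side i) = m.
  rewrite -big_split -[RHS]card_ord -sum1_card; apply: eq_bigr => i _ /=.
  by case: (side i).
rewrite !(big_sumType, sum_unit, big_bool) leaf_sum pendant_sum.
rewrite /= !sum_nat_const !card_ord muln0 muln1.
apply/eqP; move: sides; clear.
by move: (\sum_(i < m) (true == _)) (\sum_(i < m) (false == _)) => x y; lia.
Qed.

(** No cycle passes through a pendant vertex, so only the apex, the centres and the leaves remain,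
    and a count of the leaves gives at most five vertices. *)
Lemma short_cycles_cone m r : short_cycles (@cone_rel m r) [set: cone_vert m r].
Proof.
move=> c cc uc _; rewrite leqNgt; apply/negP => c6.
have c3 : 3 <= size c by apply: leq_trans c6.
pose u : cone_vert m r := inl tt; pose h b : cone_vert m r := inr (inl b).
have pendant j : (inr (inr (inr j)) : cone_vert m r) \notin c.
  apply/negP => jc; have := next_neq_prev uc c3 jc.
  have := next_cycle cc jc; have := prev_cycle cc jc.
  case: (next c _) => [?|[?|[i|?]]] //; case: (prev c _) => [?|[?|[i'|?]]] //=.
  by move=> /eqP E /eqP E' /eqP[]; congr (inr (inr (inl _))); apply: val_inj; rewrite /= E E'.
(* A leaf on the cycle is next to the apex there, so there are at most two of them. *)
suff sub : {subset c <= [:: u; h true; h false; next c u; prev c u]}.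
  by move: c6; rewrite ltnNge (uniq_leq_size uc sub).
move=> [[]|[b|[i|j]]] xc; rewrite !inE ?eqxx //; last by rewrite (negbTE (pendant j)) in xc.
  by case: b {xc}; rewrite eqxx ?orbT.
have key : next c (inr (inr (inl i))) = u \/ prev c (inr (inr (inl i))) = u.
  have := next_neq_prev uc c3 xc; have := next_cycle cc xc; have := prev_cycle cc xc.
  have := mem_next c (inr (inr (inl i))); have := mem_prev c (inr (inr (inl i))); rewrite xc.
  case: (next c _) => [[]|[b|[i1|j]]] //; [by left| |by rewrite (negbTE (pendant j))].
  case: (prev c _) => [[]|[b'|[i2|j]]] //; [by right| |by rewrite (negbTE (pendant j))].
  by move=> _ _ /= /eqP-> /eqP->; rewrite eqxx.
case: key => E; first by rewrite -[inr _](prev_next uc) E eqxx !orbT.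
by rewrite -[inr _](next_prev uc) E eqxx !orbT.
Qed.

(** Everything reduces to paths starting at a leaf: the apex and the centres are pairwise adjacent,
    and a path from a pendant vertex continues from its leaf. *)
Lemma linked_cone m r : 4 <= m -> r <= m -> linked (@cone_rel m r) [set: cone_vert m r].
Proof.
move=> m4 rm; pose V := cone_vert m r; pose e := @cone_rel m r.
pose P (x y : V) := exists2 s, upath e [set: V] x y s & 5 <= size s.
have Pmk (x y : V) s : path e x s -> last x s = y -> uniq (x :: s) -> 5 <= size s -> P x y.
  move=> ps ls us s5; exists s => //; apply/and4P; split=> //; first exact/eqP.
  by apply/allP => v; rewrite inE.
have Psym x y : P x y -> P y x.
  by case=> s /(upath_rev (@cone_sym m r))[s' us' ss'] s5; exists s'; rewrite ?ss'.
pose u : V := inl tt; pose h b : V := inr (inl b); pose l i : V := inr (inr (inl i)).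
pose p j : V := inr (inr (inr j)).
have m3 : 3 < m := m4; have m2 := ltnW m3; have m1 := ltnW m2; have m0 := ltnW m1.
have other (i : 'I_m) : exists2 i', i' != i & side i' = side i.
  case: i => -[|[|[|k]]] im; [exists (Ordinal m1)|exists (Ordinal m0)|exists (Ordinal m3)|exists (Ordinal m2)] => //.
have opposite b : exists i : 'I_m, side i = b.
  by case: b; [exists (Ordinal m2)|exists (Ordinal m0)].
(* With these tables the bodies can be cleared, and rewriting then checks each explicit path. *)
have eqs : ((forall i k, (l i == l k) = (i == k)) * (forall a b, (h a == h b) = (a == b)) *
    (forall i b, (l i == h b) = false) *
    (forall i b, (h b == l i) = false) * (forall i, (l i == u) = false) *
    (forall i, (u == l i) = false) * (forall b, (h b == u) = false) *
    (forall b, (u == h b) = false) * (u == u))%type by [].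
have adjs : ((forall i b, e (l i) (h b) = (b == side i)) * (forall i b, e (h b) (l i) = (b == side i)) *
    (forall i, e (l i) u) * (forall i, e u (l i)) * (forall b, e u (h b)) * (forall b, e (h b) u) *
    (forall a b, e (h a) (h b) = (a != b)) * (forall i k, e (l i) (l k) = false))%type by [].
pose core (x : V) := if x is inr (inr (inr _)) then false else true.
have cores : (core u * (forall b, core (h b)) * (forall i, core (l i)))%type by [].
(* Towards a neighbour of the leaf four edges suffice, because only pendant vertices use this case
   and their own edge adds the fifth. *)
have main i y : core y -> y != l i -> exists s, [/\ path e (l i) s, last (l i) s = y,
    uniq (l i :: s), all core s & 5 <= size s + e (l i) y].
  have [i' ii' si'] := other i; have [j sj] := opposite (~~ side i).
  have ji : (j == i) = false by apply/eqP => E; move: sj; rewrite E; case: (side i).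
  have ji' : (j == i') = false by apply/eqP => E; move: sj; rewrite E si'; case: (side i).
  have [ij i'j] : (i == j) = false /\ (i' == j) = false by rewrite !(eq_sym _ j).
  have [i'i i_i'] : (i' == i) = false /\ (i == i') = false by rewrite (eq_sym i); split; exact: negbTE.
  have nb b : (b == ~~ b) = false by case: b.
  have nb' b : (~~ b == b) = false by case: b.
  have sE b : b = side i \/ b = ~~ side i by case: b (side i) => [] []; [left|right|right|left].
  move=> cy yi; have : [\/ y = u, y = h (side i), y = h (~~ side i) | exists k, y = l k].
    case: y cy {yi} => [[]|[b|[k|//]]] _; [exact: Or41| |by apply: Or44; exists k].
    by have [->|->] := sE b; [apply: Or42|apply: Or43].
  clearbody core e h l p u; case=> [->|->|->|[k E]].
  - exists [:: h (side i); h (~~ side i); l j; u].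
    by rewrite /= !inE !(eqs, adjs, cores) ?(sj, ji, ij, ji', i'j, i'i, i_i', si', nb, nb', eqxx); split.
  - exists [:: u; l j; h (~~ side i); h (side i)].
    by rewrite /= !inE !(eqs, adjs, cores) ?(sj, ji, ij, ji', i'j, i'i, i_i', si', nb, nb', eqxx); split.
  - exists [:: h (side i); l i'; u; l j; h (~~ side i)].
    by rewrite /= !inE !(eqs, adjs, cores) ?(sj, ji, ij, ji', i'j, i'i, i_i', si', nb, nb', eqxx); split.
  rewrite E !eqs in yi *; have [ki ik] : (k == i) = false /\ (i == k) = false.
    by rewrite (eq_sym i); split; exact: negbTE.
  have [sk|sk] := sE (side k).
    have [jk kj] : (j == k) = false /\ (k == j) = false.
      by rewrite (eq_sym k); split; apply/eqP => jk; move: sj; rewrite jk sk; case: (side i).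
    exists [:: h (side i); h (~~ side i); l j; u; l k].
    by rewrite /= !inE !(eqs, adjs, cores) ?(sj, sk, ji, ij, ki, ik, jk, kj, nb, nb', eqxx); split.
  have [i'k ki'] : (i' == k) = false /\ (k == i') = false.
    by rewrite (eq_sym k); split; apply/eqP => i'k; move: sk; rewrite -i'k si'; case: (side i).
  exists [:: u; l i'; h (side i); h (~~ side i); l k].
  by rewrite /= !inE !(eqs, adjs, cores) ?(si', sk, i'i, i_i', ki, ik, i'k, ki', nb, nb', eqxx); split.
have pendant_notin j z s : core z -> all core s -> p j \notin z :: s.
  move=> cz cs; have ncj : ~~ core (p j) by [].
  by apply: contraNN ncj; rewrite inE => /orP[/eqP->|/(allP cs)].
have pendant_core j y : core y -> ~~ e (p j) y -> P (p j) y.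
  move=> cy ney; pose i := widen_ord rm j; have pl : e (p j) (l i) by apply/eqP.
  have yl : y != l i by apply: contraNneq ney => ->.
  have [s [ps ls us cs s4]] := main i y cy yl; apply: (Pmk _ _ (l i :: s)) => //.
  - by apply/andP.
  - by rewrite cons_uniq us pendant_notin.
  - by rewrite [size _]/=; move: s4; case: (e _ _); rewrite ?addn1 // addn0 => /leqW.
have pendants j k : j != k -> P (p j) (p k).
  move=> jk; pose i := widen_ord rm j; pose i' := widen_ord rm k.
  have pl : e (p j) (l i) by apply/eqP.
  have ii' : l i' != l i by apply: contra_neq jk => -[E]; apply/esym/val_inj.
  have [s [ps ls us cs s4]] := main i (l i') isT ii'.
  apply: (Pmk _ _ (l i :: rcons s (p k))).
  - rewrite -[path _ _ _]/(e (p j) (l i) && path e (l i) (rcons s (p k))).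
    by rewrite pl rcons_path ps ls; apply/eqP.
  - by rewrite /= last_rcons.
  - rewrite -rcons_cons cons_uniq mem_rcons rcons_uniq inE negb_or us !pendant_notin //.
    by rewrite !andbT; apply: contra_neq jk => -[].
  - by rewrite /= size_rcons; move: s4; rewrite /= addn0 => s5; apply: leqW (leqW s5).
move=> x y _ _ xy nxy; rewrite -/(P x y).
have coreE z : core z \/ exists j, z = p j by case: z => [|[|[|j]]]; [left|left|left|right; exists j].
case: (coreE x) xy nxy => [cx|[j ->]]; case: (coreE y) => [cy|[k ->]]; last 3 first.
- by rewrite [cone_rel _ _]cone_sym => _ nyx; apply/Psym/pendant_core.
- by move=> _; apply: pendant_core.
- by move=> jk _; apply: pendants; apply: contraNneq jk => ->.
move=> xy nxy.
have fromleaf i z : core z -> z != l i -> ~~ e (l i) z -> P (l i) z.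
  move=> cz zi nez; have [s [ps ls us cs]] := main i z cz zi.
  by rewrite (negbTE nez) addn0; apply: Pmk.
case: x cx xy nxy => [[]|[a|[i|//]]] _ xy nxy; last by apply: fromleaf; rewrite // eq_sym.
  by case: y cy xy nxy => [[]|[b|[i|//]]].
case: y cy xy nxy => [[]|[b|[i|//]]] // _ xy nxy.
  by case/negP: nxy; move: xy => /=; apply: contraNneq => ->.
by apply/Psym/fromleaf.
Qed.

Lemma sat_cone m r : 4 <= m -> r <= m -> saturated (cycles_geq 6) (cone m r).
Proof.
move=> m4 rm; apply/saturatedP; split; first exact: short_cycles_cone.
exact: linked_cone.
Qed.

Definition bowtie_vert : finType := (unit + ('I_3 + bool))%type.

Definition bowtie_rel : rel bowtie_vert := fun x y =>
  match x, y with
  | inl _, inl _ => false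
  | inl _, inr _ | inr _, inl _ => true
  | inr (inl i), inr (inl j) => i != j
  | inr (inr b), inr (inr b') => b != b'
  | _, _ => false
  end.

Fact bowtie_sym : symmetric bowtie_rel.
Proof. by move=> [[]|[i|b]] [[]|[j|b']] //=; rewrite eq_sym. Qed.

Fact bowtie_irr : irreflexive bowtie_rel.
Proof. by move=> [[]|[i|b]] //=; rewrite eqxx. Qed.

(* [K_4] and [K_3] sharing the vertex [inl tt]. *)
Definition bowtie : sgraph := SGraph bowtie_sym bowtie_irr.

Lemma card_bowtie : #|bowtie| = 6.
Proof. by rewrite !card_sum card_unit card_bool card_ord. Qed.

Lemma edges_bowtie : #|edges bowtie| = 9.
Proof.
apply/eqP; rewrite -(eqn_pmul2l (isT : 0 < 2)) -card_arcs card_arcs_sum.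
by rewrite !(big_sumType, sum_unit, big_bool, big_ord_recl, big_ord0).
Qed.

(** A cycle of length six would visit every vertex, yet away from the centre it would stay on one
    side. Two vertices on different sides of the centre are joined by a path through all six
    vertices. *)
Lemma sat_bowtie : saturated (cycles_geq 6) bowtie.
Proof.
apply/saturatedP; split=> [c cc uc _|x y _ _ xy nxy].
  rewrite leqNgt; apply/negP => c6.
  have cT v : v \in c.
    have sub : {subset c <= enum bowtie} by move=> w _; rewrite mem_enum.
    have c6' : size (enum bowtie) <= size c by rewrite -cardE card_bowtie.
    by have [_ ->] := uniq_min_size uc sub c6'; rewrite mem_enum.
  have [i s E] := rot_to (cT (inl tt)).
  move: cc uc; rewrite -(rot_cycle i) -(rot_uniq i) E /= rcons_path => /andP[ps _] /andP[cs _].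
  have sT v : v != inl tt -> v \in s.
    by move=> vu; have := cT v; rewrite -(mem_rot i) E inE (negbTE vu).
  pose left (v : bowtie) := if v is inr (inl _) then true else false.
  have const v t : path bowtie_rel v t -> inl tt \notin v :: t -> all (fun w => left w == left v) t.
    elim: t v => //= w t IH v /andP[vw pt]; rewrite !inE !negb_or => /and3P[nv nw nt].
    have E' : left w = left v by case: v w vw nv nw {pt IH} => [[]|[?|?]] [[]|[?|?]].
    by rewrite E' eqxx -E'; apply: IH; rewrite // inE negb_or nw.
  case: s ps sT cs {E} => [_ /(_ (inr (inr true)) isT) //|v t] /= /andP[_ pt] sT cs.
  have lE w : w \in v :: t -> left w = left v.
    by rewrite inE => /orP[/eqP->//|/(allP (const v t pt cs))/eqP].
  by have := lE _ (sT (inr (inr true)) isT); rewrite -(lE _ (sT (inr (inl ord0)) isT)).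
pose P (x y : bowtie) := exists2 s, upath bowtie_rel [set: bowtie] x y s & 5 <= size s.
have Psym v w : P v w -> P w v.
  by case=> s /(upath_rev bowtie_sym)[s' us' ss'] s5; exists s'; rewrite ?ss'.
have main i b : P (inr (inl i)) (inr (inr b)).
  have [j [k [ij jk ik]]] : exists j k : 'I_3, [/\ i != j, j != k & i != k].
    case: i => -[|[|[|//]]] i3.
    - by exists (Ordinal (isT : 1 < 3)), (Ordinal (isT : 2 < 3)).
    - by exists (Ordinal (isT : 0 < 3)), (Ordinal (isT : 2 < 3)).
    - by exists (Ordinal (isT : 0 < 3)), (Ordinal (isT : 1 < 3)).
  exists [:: inr (inl j); inr (inl k); inl tt; inr (inr (~~ b)); inr (inr b)] => //.
  apply/and4P; split=> //; last by apply/allP => v; rewrite inE.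
    by rewrite /= ij jk; case: b.
  have eqs : ((forall a a' : 'I_3, ((inr (inl a) : bowtie) == inr (inl a')) = (a == a')) *
      (forall a a', ((inr (inr a) : bowtie) == inr (inr a')) = (a == a')))%type by [].
  by rewrite !cons_uniq !in_cons !in_nil !eqs (negbTE ij) (negbTE jk) (negbTE ik); case: b.
case: x y xy nxy => [[]|[i|b]] [[]|[j|b']] // xy nxy.
- by case/negP: nxy; move: xy; apply: contraNneq => ->.
- exact: main.
- exact/Psym/main.
- by case/negP: nxy; move: xy; apply: contraNneq => ->.
Qed.

Lemma edges_lower_bound (G : sgraph) : 6 <= #|G| -> saturated (cycles_geq 6) G ->
  [/\ 3 * #|G| <= 2 * #|edges G| + 3, 2 * #|G| + 6 <= 2 * #|edges G| &
      7 <= #|G| -> 2 * #|G| + 7 <= 2 * #|edges G|].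
Proof.
move=> G6 /saturatedP satG; rewrite -card_arcs.
have [] := sat_arc_bounds (@adj_sym G) (@adj_irr G) satG; rewrite cardsT; first exact: ltnW (ltnW (ltnW G6)).
move=> /(_ set0) h /(_ G6)[h6 h7]; split=> // [|G7].
  by move: h; rewrite cards0 addn0; apply=> x; rewrite inE.
by apply: h7; left.
Qed.

Theorem theorem1p3 (n : nat) (hn : 6 <= n) :
  sat_number n (cycles_geq 6)
    (if n == 6 then 9
     else if n == 7 then 11
     else if n == 8 then 12
     else if n == 9 then 13
     else uphalf (3 * (n - 1))).
Proof.
split=> [|G Gn satG]; last first.
  have [] := edges_lower_bound _ satG; rewrite Gn // => h1 h2 h3.
  have [E|n6] := eqVneq n 6; first by move: h2; rewrite E; lia.
  (* The left side is odd, so this means e >= n + 4, the value for n = 7, 8, 9. *)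
  have {}h3 : 2 * n + 7 <= 2 * #|edges G| by apply: h3; rewrite ltn_neqAle eq_sym n6.
  do 3 (case: eqVneq => [E|_]; first by move: h3; rewrite E; lia).
  by rewrite leq_uphalf_double; lia.
have [->|n6] := eqVneq n 6; first by exists bowtie; rewrite card_bowtie edges_bowtie; split=> //; apply: sat_bowtie.
(* [cone m r] has n = m + r + 3 vertices and n + m edges, so [m] is chosen least with [4 <= m] and
   [r <= m]. *)
pose m := if n <= 9 then 4 else (n - 2)./2.
have [m4 rm nE] : [/\ 4 <= m, n - 3 - m <= m & m + (n - 3 - m) + 3 = n].
  by rewrite /m; case: ifP => n9; split; lia.
exists (cone m (n - 3 - m)); split; first by rewrite card_cone.
  exact: sat_cone.
rewrite edges_cone // /m; do 3 (case: eqVneq => [->//|?]).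
by case: ifP; lia.
Qed.
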